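(* Let $Q$ be the affine quiver of type $\widetilde{\mathbb E}_6$ with the orientation given in the context, and let $X(Q)\subset\mathbb C^7$, $X_0$, $X_1$ be as defined in the context. Then $X(Q)=X_0\cup X_1$ is a union of two rational curves. Furthermore, with respect to the lexicographic order $x_7>x_6>\dots>x_2>x_1$, the vanishing ideal of $X_0$ has Gröbner basis $\{h_0,\dots,h_7\}$, where $$\begin{aligned}h_0&=2x_1^2(2x_1^2-3x_2-1)+(x_2+1)^2,\\ h_1&=4x_1^2(3x_1^2-4x_2-1)+3(x_2+1)+2x_1x_7,\\ h_2&=x_1^3(32x_1^2-42x_2-16)+x_1(15x_2+9)+x_7(x_2+1),\\ h_3&=x_3-x_1,\quad h_4=x_4-x_2,\quad h_5=x_5-x_1,\quad h_6=x_6-x_2,\\ h_7&=x_1^4(440x_1^2-576x_2-400)+x_1^2(444x_2+198)-63x_2+2x_7^2-45,\end{aligned}$$ and the vanishing ideal of $X_1$ has Gröbner basis $\{g_0,\dots,g_7\}$, where $$\begin{aligned}g_0&=x_1^2(x_1^2-6x_2-2)+4(x_2+1)^2,\\ g_1&=x_1^2(3x_1^2-16x_2-4)+12(x_2+1)+2x_1x_7,\\ g_2&=x_1^3(4x_1^2-21x_2-8)+x_1(30x_2+18)+2x_7(x_2+1),\\ g_3&=x_3-x_1,\quad g_4=x_4-x_2,\quad g_5=x_5-x_1,\quad g_6=x_6-x_2,\\ g_7&=x_1^4(55x_1^2-288x_2-200)+x_1^2(888x_2+396)-504x_2+4x_7^2-360.\end{aligned}$$ In particular, $X_0$ and $X_1$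 are smooth curves.
   Context: The quiver $Q$ of type $\widetilde{\mathbb E}_6$ has vertices $1,\dots,7$ and arrows $7\to2\to1$, $7\to4\to3$, $7\to6\to5$. Define positive rational numbers by $a_{i,0}=1$ and $a_{i,t+1}a_{i,t}=\prod_{j\to i}a_{j,t}\cdot\prod_{i\to k}a_{k,t+1}+1$ for $t\ge0$, $1\le i\le7$ (products over arrows of $Q$; equivalently $\mathbf a_t=(a_{1,t},\dots,a_{7,t})=\mu_c^t(\mathbf x)|_{\mathbf x=(1,\dots,1)}$, where $\mu_c=\mu_7\cdots\mu_1$ is the Coxeter mutation). The frieze variety $X(Q)$ is the Zariski closure in $\mathbb C^7$ of $\{\mathbf a_t:t\ge0\}$. For $t\in\{0,\dots,5\}$, $X_t$ is the Zariski closure of $\{\mathbf a_{t+6j}:j\ge0\}$ ($6$ is the period of type $\widetilde{\mathbb E}_6$). A rational curve is an irreducible affine variety of dimension one birationally equivalent to $\mathbb C^1$. *)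

(* Defs.v *)
From mathcomp Require Import all_boot all_order all_algebra.
From mathcomp Require Import boolp classical_sets reals complex.
From mathcomp Require Import mpoly.

Set Implicit Arguments.
Unset Strict Implicit.
Unset Printing Implicit Defensive.

Import Order.TTheory GRing.Theory Num.Theory.

Local Open Scope classical_set_scope.
Local Open Scope ring_scope.

(* Classical affine varieties: subsets of K^n with its Zariski topology. *)

Section AffineGeometry.
Variable K : fieldType.

Definition aff (n : nat) := {ffun 'I_n -> K}.

Definition zeros n (T : set {mpoly K[n]}) : set (aff n) :=
  [set p | forall f, T f -> f.@[p] = 0].

Definition zclosed n (X : set (aff n)) : Prop := exists T, X = zeros T.

Definition zopen n (X : set (aff n)) : Prop := zclosed (~` X).

Definition zclosure n (S : set (aff n)) : set (aff n) :=
  [set p | forall X, zclosed X -> S `<=` X -> X p].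

Definition vanishing_ideal n (X : set (aff n)) : set {mpoly K[n]} :=
  [set f | forall p, X p -> f.@[p] = 0].

Definition irreducible n (X : set (aff n)) : Prop :=
  X !=set0 /\
  forall A B : set (aff n), zclosed A -> zclosed B ->
    X `<=` A `|` B -> X `<=` A \/ X `<=` B.

(* Strictly increasing chain Z_0 < ... < Z_d of irreducible closed subsets
   of X. *)
Definition has_chain n (X : set (aff n)) (d : nat) : Prop :=
  exists Z : nat -> set (aff n),
    (forall i, (i <= d)%N -> [/\ zclosed (Z i), irreducible (Z i) & Z i `<=` X])
    /\ (forall i, (i < d)%N -> Z i `<` Z i.+1).

Definition krull_dim n (X : set (aff n)) (d : nat) : Prop :=
  has_chain X d /\ forall e, has_chain X e -> (e <= d)%N.

(* phi is a regular function on U: it is locally a quotient of polynomials.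
   Values of phi outside U are irrelevant. *)
Definition regular_on n (U : set (aff n)) (phi : aff n -> K) : Prop :=
  forall p, U p -> exists W, [/\ zopen W, W p &
    exists f g : {mpoly K[n]}, forall q, U q -> W q ->
      g.@[q] != 0 /\ phi q = f.@[q] / g.@[q]].

Definition regular_map n m (U : set (aff n)) (V : set (aff m))
    (phi : aff n -> aff m) : Prop :=
  (forall p, U p -> V (phi p)) /\ forall i, regular_on U (fun p => phi p i).

Definition nonempty_open_in n (U X : set (aff n)) : Prop :=
  U !=set0 /\ exists W, zopen W /\ U = X `&` W.

(* For irreducible X and Y: some nonempty (hence dense) open subsets of X and
   Y are isomorphic. *)
Definition birational n m (X : set (aff n)) (Y : set (aff m)) : Prop :=
  exists (U : set (aff n)) (V : set (aff m))
         (phi : aff n -> aff m) (psi : aff m -> aff n),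
    [/\ nonempty_open_in U X, nonempty_open_in V Y,
        regular_map U V phi, regular_map V U psi &
        (forall p, U p -> psi (phi p) = p) /\
        (forall q, V q -> phi (psi q) = q)].

Definition rational_curve n (X : set (aff n)) : Prop :=
  [/\ zclosed X, irreducible X, krull_dim X 1 &
      birational X [set: aff 1]].

Definition ideal_gen n (S : set {mpoly K[n]}) : set {mpoly K[n]} :=
  [set p | exists s : seq ({mpoly K[n]} * {mpoly K[n]}),
     (forall ab, ab \in s -> S ab.2) /\ p = \sum_(ab <- s) ab.1 * ab.2].

Definition jacobian n (gs : seq {mpoly K[n]}) (p : aff n)
  : 'M[K]_(size gs, n) := \matrix_(i, j) (mderiv j gs`_i).@[p].

(* Nonsingularity of an irreducible affine variety: the Jacobian matrix of
   generators of its vanishing ideal has rank n - dim X at every point (the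
   rank does not depend on the choice of generators). *)
Definition smooth n (X : set (aff n)) : Prop :=
  exists (d : nat) (gs : seq {mpoly K[n]}),
    [/\ krull_dim X d, ideal_gen [set` gs] = vanishing_ideal X &
        forall p, X p -> \rank (jacobian gs p) = (n - d)%N].

(* Lexicographic order with 'X_(n-1) > ... > 'X_1 > 'X_0: the exponents of the
   variable of largest index are compared first. The order carried by
   'X_{1..n} itself is graded, so it cannot be used here. *)
Definition lex_lt n : rel 'X_{1..n} := fun m1 m2 =>
  [exists i : 'I_n, (m1 i < m2 i)%N &&
     [forall j : 'I_n, (i < j)%N ==> (m1 j == m2 j)]].

Definition lead_monomial n (lt : rel 'X_{1..n}) (f : {mpoly K[n]})
    (m : 'X_{1..n}) : Prop :=
  m \in msupp f /\ forall m', m' \in msupp f -> m' = m \/ lt m' m.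

Definition lead_terms n (lt : rel 'X_{1..n}) (S : set {mpoly K[n]})
  : set {mpoly K[n]} :=
  [set q | exists f m,
     [/\ S f, lead_monomial lt f m & q = f@_m *: 'X_[m]]].

Definition groebner_basis n (lt : rel 'X_{1..n}) (I : set {mpoly K[n]})
    (G : seq {mpoly K[n]}) : Prop :=
  [set` G] `<=` I /\
  ideal_gen (lead_terms lt [set` G]) = ideal_gen (lead_terms lt I).

End AffineGeometry.

Section Frieze.
Variables (n : nat) (Q : rel 'I_n).

(* Exchange at i. When every arrow i -> j of Q has j < i and the vertices are
   mutated in increasing order, all neighbours of i point to i at the moment
   when i is mutated, so that one of the two monomials of the exchange relation
   is 1 and the other is the product over all neighbours of i. *)
Definition mutate (i : 'I_n) (x : {ffun 'I_n -> rat}) : {ffun 'I_n -> rat} :=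
  [ffun l => if l == i then
     ((\prod_(j | Q j i) x j) * (\prod_(k | Q i k) x k) + 1) / x i
   else x l].

Definition coxeter_mutation (x : {ffun 'I_n -> rat}) : {ffun 'I_n -> rat} :=
  foldl (fun y i => mutate i y) x (enum 'I_n).

Definition frieze (t : nat) : {ffun 'I_n -> rat} :=
  iter t coxeter_mutation [ffun => 1].

Lemma frieze0 i : frieze 0 i = 1.
Proof. by rewrite /frieze /= ffunE. Qed.

Lemma mutate_pos i (x : {ffun 'I_n -> rat}) : (forall l, 0 < x l) -> forall l, 0 < mutate i x l.
Proof.
move=> x0 l; rewrite ffunE; case: eqP => // _.
by rewrite divr_gt0 // addr_gt0 // mulr_gt0 // prodr_gt0.
Qed.

Lemma frieze_pos t i : 0 < frieze t i.
Proof.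
elim: t i => [|t IH] i; first by rewrite frieze0.
rewrite /frieze iterS -/(frieze t) /coxeter_mutation.
elim: (enum _) (frieze t) IH => [|l s IHs] x x0 /=; first exact: x0.
by apply: IHs; apply: mutate_pos.
Qed.

Lemma foldl_mutate_notin (s : seq 'I_n) x l :
  l \notin s -> foldl (fun y i => mutate i y) x s l = x l.
Proof.
elim: s x => //= i s IH x; rewrite inE negb_or => /andP[li ls].
by rewrite IH // ffunE (negPf li).
Qed.

Lemma frieze_rec (Qdecr : forall i j, Q i j -> (j < i)%N) t i :
  frieze t.+1 i * frieze t i =
  (\prod_(j | Q j i) frieze t j) * (\prod_(k | Q i k) frieze t.+1 k) + 1.
Proof.
have xi0 : frieze t i != 0 by rewrite gt_eqF ?frieze_pos.
rewrite /frieze iterS -/(frieze t) /coxeter_mutation.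
have sz : (i < size (enum 'I_n))%N by rewrite size_enum_ord.
have nthi : nth i (enum 'I_n) i = i by rewrite nth_ord_enum.
have e : enum 'I_n = take i (enum 'I_n) ++ i :: drop i.+1 (enum 'I_n).
  by rewrite -[in LHS](cat_take_drop i (enum 'I_n)) (drop_nth i sz) nthi.
have U : uniq (enum 'I_n) by rewrite enum_uniq.
have ipre (l : 'I_n) : (l \in take i (enum 'I_n)) = (l < i)%N.
  by rewrite in_take ?mem_enum // index_enum_ord.
rewrite e cat_uniq in U; case/and3P: U => _ U1 /= /andP[U2 U3].
have isuf (l : 'I_n) : (l < i)%N -> l \notin drop i.+1 (enum 'I_n).
  move=> li; apply/negP => ls; move/hasPn: U1 => /(_ l).
  by rewrite inE ls orbT => /(_ isT); rewrite /= ipre li.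
rewrite {1}e foldl_cat /= foldl_mutate_notin // ffunE eqxx.
set y := foldl _ _ (take _ _).
have yx (l : 'I_n) : (i <= l)%N -> y l = frieze t l.
  by move=> il; rewrite /y foldl_mutate_notin // ipre -leqNgt.
rewrite (yx i) // divfK //; congr (_ * _ + 1); apply: eq_bigr => l Ql.
  by rewrite yx // ltnW // Qdecr.
have li := Qdecr _ _ Ql.
rewrite [in RHS]e foldl_cat /= foldl_mutate_notin ?isuf // ffunE.
by rewrite (_ : (l == i) = false) // -val_eqE /= ltn_eqF.
Qed.

End Frieze.

(* The vertex or variable numbered k, 1 <= k <= 7, is the ordinal k - 1. *)

Definition quiverE6 : rel 'I_7 := fun i j =>
  (i.+1, j.+1) \in
    [:: (7, 2); (2, 1); (7, 4); (4, 3); (7, 6); (6, 5)]%N.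

Lemma quiverE6_decr i j : quiverE6 i j -> (j < i)%N.
Proof.
rewrite /quiverE6 !inE !xpair_eqE !eqSS.
by do !case/orP; case/andP => /eqP-> /eqP->.
Qed.

Section FriezeVariety.
Variable K : fieldType.

Definition frieze_point (t : nat) : aff K 7 :=
  [ffun i => ratr (frieze quiverE6 t i)].

Definition frieze_variety : set (aff K 7) :=
  zclosure (range frieze_point).

Definition frieze_component (t : nat) : set (aff K 7) :=
  zclosure (range (fun j : nat => frieze_point (t + 6 * j)%N)).

Definition xvar (k : nat) : {mpoly K[7]} := 'X_(inord k.-1).

Definition h_basis : seq {mpoly K[7]} :=
  let x1 := xvar 1 in let x2 := xvar 2 in let x3 := xvar 3 in
  let x4 := xvar 4 in let x5 := xvar 5 in let x6 := xvar 6 in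
  let x7 := xvar 7 in
  [:: 2 * x1 ^+ 2 * (2 * x1 ^+ 2 - 3 * x2 - 1) + (x2 + 1) ^+ 2;
      4 * x1 ^+ 2 * (3 * x1 ^+ 2 - 4 * x2 - 1) + 3 * (x2 + 1) + 2 * x1 * x7;
      x1 ^+ 3 * (32 * x1 ^+ 2 - 42 * x2 - 16) + x1 * (15 * x2 + 9)
        + x7 * (x2 + 1);
      x3 - x1;
      x4 - x2;
      x5 - x1;
      x6 - x2;
      x1 ^+ 4 * (440 * x1 ^+ 2 - 576 * x2 - 400)
        + x1 ^+ 2 * (444 * x2 + 198) - 63 * x2 + 2 * x7 ^+ 2 - 45].

Definition g_basis : seq {mpoly K[7]} :=
  let x1 := xvar 1 in let x2 := xvar 2 in let x3 := xvar 3 in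
  let x4 := xvar 4 in let x5 := xvar 5 in let x6 := xvar 6 in
  let x7 := xvar 7 in
  [:: x1 ^+ 2 * (x1 ^+ 2 - 6 * x2 - 2) + 4 * (x2 + 1) ^+ 2;
      x1 ^+ 2 * (3 * x1 ^+ 2 - 16 * x2 - 4) + 12 * (x2 + 1) + 2 * x1 * x7;
      x1 ^+ 3 * (4 * x1 ^+ 2 - 21 * x2 - 8) + x1 * (30 * x2 + 18)
        + 2 * x7 * (x2 + 1);
      x3 - x1;
      x4 - x2;
      x5 - x1;
      x6 - x2;
      x1 ^+ 4 * (55 * x1 ^+ 2 - 288 * x2 - 200)
        + x1 ^+ 2 * (888 * x2 + 396) - 504 * x2 + 4 * x7 ^+ 2 - 360].

End FriezeVariety.

Arguments frieze_variety K : clear implicits.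
Arguments frieze_component K t : clear implicits.

(* Main.v *)
(* By the symmetry of the quiver, a frieze point has the form
   (x, y, x, y, x, y, r). Its coordinates are polynomials in a
   pair (x, s) of solutions of s^2 = 5 x^2 - 4 (odd-indexed Fibonacci and Lucas
   numbers), and one mutation step is (x, s) |-> ((3x + s) / 2, (5x + 3s) / 2),
   except that x and r carry a factor c which is 1 for even t and 2 for odd t.
   So the frieze points lie on two copies, c = 1 and c = 2, of the hyperbola,
   embedded in affine 7-space by a polynomial map whose inverse is polynomial.
   Modulo its equations every polynomial is a(x) + b(x) s; the norm
   a^2 - b^2 (5 x^2 - 4) shows that a closed subset of such a curve is finite or
   everything, which gives density of the frieze points, irreducibility,
   dimension 1 and the vanishing ideal. For the Groebner bases, a leading monomial
   divisible by none of x2^2, x1 x7, x2 x7, x3, x4, x5, x6, x7^2 is x1^a, x1^a x2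
   or x7, and no polynomial vanishing on the curve has such a leading monomial. *)

Require Import Defs.
From mathcomp Require Import all_boot all_order all_algebra.
From mathcomp Require Import boolp classical_sets reals complex.
From mathcomp Require Import mpoly.
From mathcomp Require Import ring lra zify.

Import Order.TTheory GRing.Theory Num.Theory.

Local Open Scope classical_set_scope.
Local Open Scope ring_scope.

(** * Affine varieties *)

Section AffineGeometry.
Context {K : fieldType}.

(** * Ideals generated by sets of polynomials *)

Section Ideals.
Context {n : nat}.
Implicit Types S T : set {mpoly K[n]}.

Lemma ideal_gen_sub S : S `<=` ideal_gen S.
Proof.
move=> p Sp; exists [:: (1, p)]; split; last by rewrite big_seq1 mul1r.
by move=> ab; rewrite inE => /eqP->.
Qed.

Lemma ideal_gen0 S : ideal_gen S 0.
Proof. by exists [::]; rewrite big_nil. Qed.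

Lemma ideal_genD S p q : ideal_gen S p -> ideal_gen S q -> ideal_gen S (p + q).
Proof.
move=> [s [Ss ->]] [t [St ->]]; exists (s ++ t); split; last by rewrite big_cat.
by move=> ab; rewrite mem_cat => /orP[/Ss|/St].
Qed.

Lemma ideal_genMl S p q : ideal_gen S q -> ideal_gen S (p * q).
Proof.
move=> [s [Ss ->]]; exists [seq (p * ab.1, ab.2) | ab <- s]; split.
  by move=> ab /mapP[cd /Ss ? ->].
by rewrite big_map mulr_sumr; apply: eq_bigr => ab _; rewrite mulrA.
Qed.

Lemma ideal_gen_idem S T : S `<=` ideal_gen T -> ideal_gen S `<=` ideal_gen T.
Proof.
move=> ST _ [s [Ss ->]]; elim: s Ss => [|ab s IH] Ss.
  by rewrite big_nil; apply: ideal_gen0.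
rewrite big_cons; apply: ideal_genD.
  by apply/ideal_genMl/ST/Ss; rewrite mem_head.
by apply: IH => cd cds; apply: Ss; rewrite inE cds orbT.
Qed.

Lemma ideal_genP S T : S `<=` T -> ideal_gen S `<=` ideal_gen T.
Proof. by move=> ST; apply: ideal_gen_idem => p /ST; apply: ideal_gen_sub. Qed.

Lemma ideal_gen_vanish S (p : aff K n) f :
  (forall g, S g -> g.@[p] = 0) -> ideal_gen S f -> f.@[p] = 0.
Proof.
move=> Sp [s [Ss ->]]; rewrite raddf_sum big_seq big1 // => ab /Ss /Sp /= h.
by rewrite mevalM h mulr0.
Qed.

End Ideals.

(** * Zariski-closed sets, irreducibility and dimension *)

Section Closed.
Context {n : nat}.
Implicit Types X Y Z S : set (aff K n).

Lemma zclosed_zeros T : zclosed (@zeros K n T).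
Proof. by exists T. Qed.

Lemma zclosure_min S X : zclosed X -> S `<=` X -> zclosure S `<=` X.
Proof. by move=> Xc SX p; apply. Qed.

Lemma zclosure_mono S X : S `<=` X -> zclosure S `<=` zclosure X.
Proof. by move=> SX p Sp Z Zc XZ; apply: Sp => // q /SX /XZ. Qed.

(** Products of an equation of [X] with one of [Y] cut out the union: where some [f] of [S] is
    nonzero, every [g] of [T] must vanish. *)
Lemma zclosedU X Y : zclosed X -> zclosed Y -> zclosed (X `|` Y).
Proof.
move=> [S ->] [T ->].
exists [set h | exists f g, [/\ S f, T g & h = f * g]].
apply/seteqP; split=> p /=.
  case=> Hp _ [f [g [Sf Tg ->]]]; rewrite mevalM.
    by rewrite (Hp _ Sf) mul0r.
  by rewrite (Hp _ Tg) mulr0.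
move=> Hp; case: (pselect (zeros S p)) => [|/existsPNP[f Sf /eqP fp]].
  by left.
right=> g Tg; have /eqP : (f * g).@[p] = 0 by apply: Hp; exists f, g.
by rewrite mevalM mulf_eq0 (negPf fp) => /eqP.
Qed.

Lemma zclosed1 (p : aff K n) : zclosed [set p].
Proof.
exists [set f | exists i, f = 'X_i - (p i)%:MP].
apply/seteqP; split=> q /=.
  by move=> -> _ [i ->]; rewrite mevalB mevalXU mevalC subrr.
move=> Hq; apply/ffunP => i; apply/eqP; rewrite -subr_eq0.
have <- : ('X_i - (p i)%:MP).@[q] = 0 by apply: Hq; exists i.
by rewrite mevalB mevalXU mevalC.
Qed.

Lemma zclosed0 : zclosed (@set0 (aff K n)).
Proof.
exists [set 1]; apply/seteqP; split=> p //= /(_ _ erefl) /eqP.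
by rewrite meval1 oner_eq0.
Qed.

Lemma zclosed_seq (l : seq (aff K n)) : zclosed [set` l].
Proof.
elim: l => [|p l IH].
  by rewrite (_ : [set` _] = set0) ?predeqE //; apply: zclosed0.
rewrite (_ : [set` _] = [set p] `|` [set` l]).
  exact: zclosedU (zclosed1 p) IH.
apply/seteqP; split=> q /=; rewrite inE.
  by case/orP => [/eqP|]; [left|right].
by case=> [->|->]; rewrite ?eqxx ?orbT.
Qed.

(** Points are peeled off the list: irreducibility puts [Z] inside the first point or inside the
    rest. *)
Lemma irreducible_seq Z (l : seq (aff K n)) :
  irreducible Z -> Z `<=` [set` l] -> exists p, Z = [set p].
Proof.
move=> [[z Zz] Zirr]; elim: l => [/(_ _ Zz)//|p l IH] Zl.
have [|Zp|] := Zirr _ _ (zclosed1 p) (zclosed_seq l) => //.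
- by move=> q /Zl; rewrite /= inE => /orP[/eqP|]; [left|right].
- exists p; apply/seteqP; split=> // q ->.
  by rewrite -(Zp _ Zz).
Qed.

Lemma irreducible1 (p : aff K n) : irreducible [set p].
Proof.
split; first by exists p.
by move=> A B _ _ /(_ p erefl) [Ap|Bp]; [left|right] => _ ->.
Qed.

Lemma rational_regular (U : set (aff K n)) (phi : aff K n -> K) :
  (exists f g : {mpoly K[n]},
    forall q, U q -> g.@[q] != 0 /\ phi q = f.@[q] / g.@[q]) ->
  regular_on U phi.
Proof.
move=> [f [g fg]] p Up; exists setT; split=> //.
  by rewrite /zopen setCT; apply: zclosed0.
by exists f, g => q Uq _; apply: fg.
Qed.

(** Easy to check on a parametrized curve, this property yields irreducibility, density of infinite
    subsets and, for closed [X], dimension 1. *)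
Definition cofinite_topology X : Prop :=
  (forall l : seq (aff K n), exists2 p, X p & p \notin l) /\
  forall f : {mpoly K[n]}, vanishing_ideal X f \/
    exists l : seq (aff K n), forall p, X p -> f.@[p] = 0 -> p \in l.

Section Cofinite.
Context {X : set (aff K n)} (Xcof : cofinite_topology X).

Lemma cofinite_closed Z : zclosed Z ->
  X `<=` Z \/ exists l : seq (aff K n), X `&` Z `<=` [set` l].
Proof.
case: Xcof => _ Xfin [T ->].
case: (pselect (X `<=` zeros T)) => [|/existsPNP[p Xp /existsPNP[f Tf fp]]].
  by left.
right; have [/(_ _ Xp)//|[l Hl]] := Xfin f.
by exists l => q [Xq /(_ _ Tf)]; apply: Hl.
Qed.

Lemma cofinite_irreducible : irreducible X.
Proof.
have [Xinf _] := Xcof; split; first by have [p Xp _] := Xinf [::]; exists p.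
move=> A B /cofinite_closed[XA _ _|[lA hA]]; first by left.
move=> /cofinite_closed[XB _|[lB hB]]; first by right.
have [p Xp] := Xinf (lA ++ lB); rewrite mem_cat negb_or => /andP[pA pB] XAB.
case: (XAB _ Xp) => [Ap|Bp].
  by have := hA p (conj Xp Ap); rewrite /= (negPf pA).
by have := hB p (conj Xp Bp); rewrite /= (negPf pB).
Qed.

Lemma cofinite_dense S :
  zclosed X -> S `<=` X ->
  (forall l : seq (aff K n), exists2 p, S p & p \notin l) -> zclosure S = X.
Proof.
move=> Xc SX Sinf; apply/seteqP; split; first exact: zclosure_min.
move=> p Xp Z /cofinite_closed[XZ _|[l Hl] SZ]; first exact: XZ.
have [q Sq] := Sinf l.
by have /= -> := Hl _ (conj (SX _ Sq) (SZ _ Sq)).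
Qed.

Lemma cofinite_krull_dim : zclosed X -> krull_dim X 1.
Proof.
move=> Xc; have [Xinf _] := Xcof.
have [p Xp _] := Xinf [::]; have [q Xq] := Xinf [:: p].
rewrite inE => qp; split.
  exists (fun i => if i is 0%N then [set p] else X); split.
    case=> [_|i _]; split=> //.
    - exact: zclosed1.
    - exact: irreducible1.
    - by move=> _ ->.
    - exact: cofinite_irreducible.
  case=> // _; split=> [r ->//|/(_ _ Xq) /= qp'].
  by rewrite qp' eqxx in qp.
move=> e [Z [Zirr Zlt]]; rewrite leqNgt; apply/negP => e2.
have [Z1c Z1irr Z1X] := Zirr 1%N (ltnW e2).
have [_ [[z Z0z] _] _] := Zirr 0%N isT.
have [Z01 nZ10] := Zlt 0%N (ltnW e2).
have [_ nZ21] := Zlt 1%N e2; have [_ _ Z2X] := Zirr 2%N e2.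
(* [Z 1] is properly contained in [Z 2], so it misses part of [X]. It is then finite, hence a single
   point by irreducibility, and leaves no room for [Z 0]. *)
have [XZ1|[l Hl]] := cofinite_closed _ Z1c.
  by apply: nZ21 => r /Z2X /XZ1.
have [|r Z1r] := irreducible_seq _ l Z1irr.
  by move=> r Zr; apply: Hl; split=> //; apply: Z1X.
apply: nZ10; rewrite Z1r => _ ->.
by have := Z01 _ Z0z; rewrite Z1r => <-.
Qed.

End Cofinite.
End Closed.
End AffineGeometry.

(** * Frieze points and the hyperbola s^2 = 5 x^2 - 4 *)

Section Parametrization.
Context {F : fieldType}.
Implicit Types c x s : F.

(** The exchange relation at a leaf solved for its neighbour: with x' = (3x + s) / 2 it reads 2 x x'
    = y + 1. *)
Definition y_of x s : F := 3 * x ^+ 2 + x * s - 1.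

(** The exchange relation at a middle vertex, y y' = 2 r x' + 1, solved for r; modulo s^2 = 5x^2 - 4
    the quotient is this polynomial. *)
Definition r_of x s : F :=
  18 * x ^+ 3 + 8 * x ^+ 2 * s - 21 / 2 * x - 3 / 2 * s.

Definition coords c x s : seq F :=
  [:: c * x; y_of x s; c * x; y_of x s; c * x; y_of x s; c * r_of x s].

Definition curve_pt c x s : aff F 7 := [ffun i : 'I_7 => (coords c x s)`_i].

Definition curve c : set (aff F 7) :=
  [set p | exists x s, s ^+ 2 = 5 * x ^+ 2 - 4 /\ p = curve_pt c x s].

End Parametrization.

Definition hyperbola_step (xs : rat * rat) : rat * rat :=
  ((3 * xs.1 + xs.2) / 2, (5 * xs.1 + 3 * xs.2) / 2).

(** The entry at t is (F_{2t-1}, L_{2t-1}), Fibonacci and Lucas numbers. Of the two points with x =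
    1, only s = -1 gives y = r = 1. *)
Definition hyperbola_seq (t : nat) : rat * rat := iter t hyperbola_step (1, -1).

(** Each exchange relation involves the scales only through the product of two consecutive ones,
    which is 2. *)
Definition scale (t : nat) : rat := if odd t then 2 else 1.

Lemma hyperbola_seqP t :
  (hyperbola_seq t).2 ^+ 2 = 5 * (hyperbola_seq t).1 ^+ 2 - 4.
Proof.
elim: t => [|t /= IH]; first by rewrite /=; field.
rewrite /hyperbola_step /= -/(hyperbola_seq t).
by field: IH.
Qed.

(** The bound on x + s carries the induction, since s starts at -1: x' = x + (x + s) / 2 and x' + s'
    = 2x + 2(x + s). *)
Lemma hyperbola_seq_gt0 t :
  0 < (hyperbola_seq t).1 /\ 0 <= (hyperbola_seq t).1 + (hyperbola_seq t).2.
Proof.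
elim: t => [|t [IH1 IH2]]; first by rewrite /=; lra.
rewrite /= /hyperbola_step /= -/(hyperbola_seq t); split; lra.
Qed.

(** At least two steps are taken because the first two values of x are both 1. *)
Lemma hyperbola_seq_lt t k :
  (hyperbola_seq t).1 < (hyperbola_seq (k.+2 + t)).1.
Proof.
elim: k => [|k IH]; last apply: (lt_le_trans IH).
  have [] := hyperbola_seq_gt0 t.
  rewrite /= /hyperbola_step /= -/(hyperbola_seq t); lra.
rewrite [(k.+3 + t)%N]/= addSn.
have [] := hyperbola_seq_gt0 (k.+2 + t).
rewrite /= /hyperbola_step /= -/(hyperbola_seq _); lra.
Qed.

(** Reading the coordinates through functions on [nat] lets the products over the seven vertices
    reduce to values at numerals. *)
Lemma frieze_exchange t (f f' : nat -> rat) (i : 'I_7) :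
  (forall j : 'I_7, frieze quiverE6 t j = f j) ->
  (forall j : 'I_7, frieze quiverE6 t.+1 j = f' j) ->
  f' i * f i =
  (\prod_(j < 7 | quiverE6 j i) f j) * (\prod_(k < 7 | quiverE6 i k) f' k) + 1.
Proof.
move=> Hf Hf'; rewrite -Hf -Hf' (frieze_rec quiverE6_decr).
by congr (_ * _ + 1); apply: eq_bigr.
Qed.

Lemma frieze_curve_pt t :
  frieze quiverE6 t =
  curve_pt (scale t) (hyperbola_seq t).1 (hyperbola_seq t).2.
Proof.
elim: t => [|t IH].
  apply/ffunP => i; rewrite frieze0 ffunE /coords /y_of /r_of /=.
  by case: i => [[|[|[|[|[|[|[|?]]]]]]] ?] //=; field.
have xs := hyperbola_seqP t; have [x0 _] := hyperbola_seq_gt0 t.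
pose f k := (coords (scale t) (hyperbola_seq t).1 (hyperbola_seq t).2)`_k.
pose f' k := frieze quiverE6 t.+1 (inord k).
have ft (j : 'I_7) : frieze quiverE6 t j = f j by rewrite IH ffunE.
have ft' (j : 'I_7) : frieze quiverE6 t.+1 j = f' j by rewrite /f' inord_val.
have ex i := frieze_exchange t f f' i ft ft'.
have f0 (j : 'I_7) : f j != 0 by rewrite -ft lt0r_neq0 ?frieze_pos.
apply/ffunP => i; rewrite ffunE ft' /=.
rewrite /hyperbola_step /=.
move: x0 xs f0 ex; rewrite /f; case: (hyperbola_seq t) => x s /= x0 xs f0 ex.
have cc : scale t * scale t.+1 = 2 by rewrite /scale /=; case: odd.

have e k (lt_k7 : (k < 7)%N) := ex (Ordinal lt_k7).
have e0 := e 0 isT; have e1 := e 1 isT; have e2 := e 2 isT; have e3 := e 3 isT.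
have e4 := e 4 isT; have e5 := e 5 isT; have e6 := e 6 isT.
move: e0 e1 e2 e3 e4 e5 e6.
rewrite !(big_mkcond (fun j : 'I_7 => quiverE6 _ _)) /= !big_ord_recl !big_ord0.
rewrite /quiverE6 /= !(mul1r, mulr1) /bump /= => e0 e1 e2 e3 e4 e5 e6.
have cx0 : scale t * x != 0 by exact: f0 (@Ordinal 7 0 isT).
have y0 : y_of x s != 0 by exact: f0 (@Ordinal 7 1 isT).
have r0 : scale t * r_of x s != 0 by exact: f0 (@Ordinal 7 6 isT).
set x' := (3 * x + s) / 2; set s' := (5 * x + 3 * s) / 2.
(* The old values are nonzero, so the relations determine the new ones: first at the leaves, which
   use old values only, then at the middle vertices, then at vertex 7. *)
have leaf z : z * (scale t * x) = y_of x s + 1 -> z = scale t.+1 * x'.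
  move=> ez; apply: (mulIf cx0); rewrite ez mulrACA [scale t.+1 * _]mulrC cc.
  by rewrite /x' /y_of; field.
have mid z : z * y_of x s = scale t * r_of x s * (scale t.+1 * x') + 1 ->
    z = y_of x' s'.
  move=> ez; apply: (mulIf y0); rewrite ez mulrACA cc /x' /s' /y_of /r_of.
  by field: xs.
have {e0 e2 e4} [e0 e2 e4] := And3 (leaf _ e0) (leaf _ e2) (leaf _ e4).
rewrite e0 in e1; rewrite e2 in e3; rewrite e4 in e5.
have {e1 e3 e5} [e1 e3 e5] := And3 (mid _ e1) (mid _ e3) (mid _ e5).
have {}e6 : f' 6 = scale t.+1 * r_of x' s'.
  apply: (mulIf r0); rewrite e6 e1 e3 e5 mulrACA [scale t.+1 * _]mulrC cc.
  by rewrite /x' /s' /y_of /r_of; field: xs.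
by case: i => [[|[|[|[|[|[|[|?]]]]]]] ?].
Qed.

(** * Polynomial functions on the hyperbola *)

Section PolynomialsOnHyperbola.
Context {K : numClosedFieldType}.
Implicit Types (a b : {poly K}) (x s : K).

(** In characteristic 0 the integers 0, ..., [size a] - 1 are distinct, too many roots for a nonzero
    [a]. *)
Lemma horner_eq0 a : (forall x, a.[x] = 0) -> a = 0.
Proof.
move=> Ha; apply/eqP/negPn/negP => a0.
pose rs : seq K := [seq i%:R | i <- iota 0 (size a)].
have rs_root : all (root a) rs by apply/allP => x _; apply/rootP.
have rs_uniq : uniq rs.
  by rewrite map_inj_uniq ?iota_uniq // => i j /eqP; rewrite eqr_nat => /eqP.
by have := max_poly_roots a0 rs_root rs_uniq; rewrite size_map size_iota ltnn.
Qed.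

(* 5X^2 - 4 has simple roots, so it has odd order at each of them, unlike a
   quotient of squares. *)
Lemma norm_eq0 a b : a ^+ 2 = b ^+ 2 * (5 * 'X ^+ 2 - 4) -> a = 0 /\ b = 0.
Proof.
have z5 : sqrtC (5 : K) ^+ 2 = 5 by rewrite sqrtCK.
have z0 : sqrtC (5 : K) != 0 by rewrite sqrtC_eq0 pnatr_eq0.
pose rho : K := 2 / sqrtC 5.
have rho0 : rho != 0 by rewrite mulf_neq0 ?invr_eq0 ?pnatr_eq0.
have r2 : rho ^+ 2 * 5 = 4 by rewrite -z5 /rho; field.
set D := 5 * 'X ^+ 2 - 4.
have DE : D = (5 *: ('X + rho%:P)) * ('X - rho%:P).
  have -> : D = 5%:P * 'X^2 - (rho ^+ 2 * 5)%:P by rewrite r2 !polyC_natr.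
  by rewrite -mul_polyC rmorphM rmorphXn /=; ring.
have nroot : ~~ root (5 *: ('X + rho%:P)) rho.
  by rewrite rootE !hornerE -mulr2n mulf_neq0 ?pnatr_eq0 ?mulrn_eq0.
have D0 : D != 0.
  rewrite DE mulf_neq0 ?polyXsubC_eq0 //.
  by apply: contra nroot => /eqP ->; rewrite root0.
have mD : mup rho D = 1%N.
  by rewrite DE mupMr // -['X - _]expr1 mup_XsubCX eqxx.
move=> e; have b0 : b = 0.
  apply/eqP/negPn/negP => b0.
  have a0 : a != 0.
    have : a ^+ 2 != 0 by rewrite e mulf_neq0 // expf_neq0.
    by rewrite expf_eq0.
  have /(congr1 (fun p => odd (mup rho p))) := e.
  rewrite [X in _ = odd X]mupM ?expf_neq0 // mD !expr2 !mupM // !oddD.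
  by do 2 case: odd.
split=> //; apply/eqP; move: e; rewrite b0 expr0n mul0r => /eqP.
by rewrite expf_eq0.
Qed.

(** The product of a + b s with its conjugate a - b s. *)
Definition pol_norm a b := a ^+ 2 - b ^+ 2 * (5 * 'X ^+ 2 - 4).

Lemma pol_norm_eq0 a b : pol_norm a b = 0 -> a = 0 /\ b = 0.
Proof. by move/eqP; rewrite subr_eq0 => /eqP; apply: norm_eq0. Qed.

Lemma horner_pol_norm a b x s : s ^+ 2 = 5 * x ^+ 2 - 4 ->
  a.[x] + b.[x] * s = 0 -> (pol_norm a b).[x] = 0.
Proof.
move=> xs /eqP; rewrite addr_eq0 => /eqP ax.
rewrite /pol_norm !(hornerD, hornerN, hornerM, hornerXn, horner_exp, hornerMn).
rewrite !(hornerX, hornerC) ax.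
by ring: xs.
Qed.

(** Square roots exist in [K], so every [x] lies under a point of the hyperbola and the norm
    vanishes identically. *)
Lemma vanish_on_hyperbola a b :
  (forall x s, s ^+ 2 = 5 * x ^+ 2 - 4 -> a.[x] + b.[x] * s = 0) ->
  a = 0 /\ b = 0.
Proof.
move=> H; apply/pol_norm_eq0/horner_eq0 => x.
have e : sqrtC (5 * x ^+ 2 - 4) ^+ 2 = 5 * x ^+ 2 - 4 by rewrite sqrtCK.
exact: horner_pol_norm e (H _ _ e).
Qed.

End PolynomialsOnHyperbola.

(** * The ideal of the curve *)

Lemma curve_pt_coord (F : fieldType) (c x s : F) k : (k < 7)%N ->
  curve_pt c x s (inord k) = (coords c x s)`_k.
Proof. by move=> k7; rewrite ffunE inordK. Qed.

Lemma curve_pt_inj_x (F : fieldType) (c x s x' s' : F) : c != 0 ->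
  curve_pt c x s = curve_pt c x' s' -> x = x'.
Proof.
move=> c0 /(congr1 (fun p : aff F 7 => p ord0)); rewrite !ffunE /=.
exact: mulfI.
Qed.

Lemma meval_nat (F : comNzRingType) n (v : 'I_n -> F) k :
  (k%:R : {mpoly F[n]}).@[v] = k%:R.
Proof. exact: rmorph_nat. Qed.

Lemma meval_exp (F : comNzRingType) n (v : 'I_n -> F) (f : {mpoly F[n]}) k :
  (f ^+ k).@[v] = f.@[v] ^+ k.
Proof. exact: rmorphXn. Qed.

Definition meval_ringE := (meval_nat, mevalXU, mevalC, meval1, meval_exp,
  mevalB, mevalD, mevalN, mevalM).

Lemma infinite_notin (T : eqType) (f : nat -> T) (l : seq T) :
  injective f -> exists k, f k \notin l.
Proof.
move=> f_inj; apply: contrapT => /forallNP Hf.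
have sub : {subset map f (iota 0 (size l).+1) <= l}.
  by move=> _ /mapP[k _ ->]; move/negP: (Hf k); rewrite negbK.
have := @uniq_leq_size _ _ _ _ sub; rewrite map_inj_uniq ?iota_uniq //.
rewrite size_map size_iota.
by rewrite ltnn => /(_ isT).
Qed.

Section Generators.
Context {K : numClosedFieldType} (c : K).
Hypothesis c0 : c != 0.
Implicit Types (f g : {mpoly K[7]}) (a b : {poly K}) (x s : K).

Let x : {mpoly K[7]} := c^-1%:MP * xvar K 1.
Let w : {mpoly K[7]} := xvar K 2 + 1.
Let r : {mpoly K[7]} := c^-1%:MP * xvar K 7.

(* The coordinate s as a polynomial function on the curve: eliminate x * s
   between the formulas for y and r. *)
Definition s_poly : {mpoly K[7]} :=
  3^-1%:MP * (- 12 * x ^+ 3 + 16 * x * w - 21 * x - 2 * r).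

(** No generator expresses x7, which is recovered from the formula of [s_poly]. Six generators match
    the codimension, so smoothness becomes full row rank of the Jacobian. *)
Definition curve_gens : seq {mpoly K[7]} :=
  [:: w - 3 * x ^+ 2 - x * s_poly; s_poly ^+ 2 - 5 * x ^+ 2 + 4;
      xvar K 3 - xvar K 1; xvar K 4 - xvar K 2;
      xvar K 5 - xvar K 1; xvar K 6 - xvar K 2].

Lemma meval_s_polyE (p : aff K 7) : s_poly.@[p] =
  3^-1 * (- 12 * (c^-1 * p (inord 0)) ^+ 3 +
  16 * (c^-1 * p (inord 0)) * (p (inord 1) + 1) - 21 * (c^-1 * p (inord 0)) -
  2 * (c^-1 * p (inord 6))).
Proof. by rewrite /s_poly /x /w /r /xvar !meval_ringE. Qed.

Lemma meval_s_poly z s : s_poly.@[curve_pt c z s] = s.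
Proof.
rewrite meval_s_polyE !curve_pt_coord //= /y_of /r_of.
by field.
Qed.

Lemma curve_zeros : curve c = zeros [set` curve_gens].
Proof.
apply/seteqP; split=> p.
  move=> [z [s [zs ->]]] f; rewrite /curve_gens /= !inE.
  move: s_poly (meval_s_poly z s) => S eS.
  do !case/orP; move/eqP=> ->;
  rewrite !meval_ringE ?eS /x /w /xvar ?meval_ringE ?curve_pt_coord //= ?subrr //.
  - by rewrite /y_of; field.
  - by field: zs.
move=> Hp; exists (x.@[p]), (s_poly.@[p]).
have e k : (k < 6)%N -> (curve_gens`_k).@[p] = 0.
  by move=> k6; apply: Hp; rewrite /= mem_nth.
have := e 5%N isT; have := e 4%N isT; have := e 3%N isT; have := e 2%N isT.
have := e 1%N isT; have := e 0%N isT; rewrite /curve_gens /= {e}.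
have es := meval_s_polyE p; move: s_poly es => S.
rewrite /x /w /xvar !meval_ringE; move: (S.@[p]) => s {S} /=.
move=> es e0 e1 e2 e3 e4 e5; split.
  by apply/eqP; rewrite -subr_eq0 -e1; apply/eqP; ring.
have cK u : c * (c^-1 * u) = u by rewrite mulrA divff ?mul1r.
have p0 := esym (cK (p (inord 0))).
have p6 := cK (p (inord 6)).
move: (c^-1 * p (inord 0)) (c^-1 * p (inord 6)) p0 p6 es e0 {e1} => z q p0 p6 es e0.
have py : p (inord 1) = y_of z s.
  apply/eqP; rewrite -subr_eq0 -e0 /y_of; apply/eqP; ring.
have {}es : 3 * s = - 12 * z ^+ 3 + 16 * z * (y_of z s + 1) - 21 * z - 2 * q.
  by rewrite {1}es py; field.
have {}p6 : p (inord 6) = c * r_of z s.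
  rewrite -p6; congr (c * _); rewrite /r_of.
  have -> : 3 / 2 * s = 3 * s / 2 by field.
  by rewrite es /y_of; field.
apply/ffunP => i; rewrite -(inord_val i) curve_pt_coord //.
move/eqP: e2; move/eqP: e3; move/eqP: e4; move/eqP: e5; rewrite !subr_eq0.
move=> /eqP e5 /eqP e4 /eqP e3 /eqP e2.
by case: i => [[|[|[|[|[|[|[|?]]]]]]] ?] //=; rewrite ?(e2, e3, e4, e5).
Qed.

Definition pol_x (a : {poly K}) : {mpoly K[7]} := horner_alg x a.

Lemma pol_xC k : pol_x k%:P = k%:MP.
Proof. by rewrite /pol_x horner_algC alg_mpolyC. Qed.

Lemma pol_xX : pol_x 'X = x.
Proof. exact: horner_algX. Qed.

Lemma pol_xD a b : pol_x (a + b) = pol_x a + pol_x b.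
Proof. exact: rmorphD. Qed.

Lemma pol_xB a b : pol_x (a - b) = pol_x a - pol_x b.
Proof. exact: rmorphB. Qed.

Lemma pol_xM a b : pol_x (a * b) = pol_x a * pol_x b.
Proof. exact: rmorphM. Qed.

Lemma pol_x_exp a k : pol_x (a ^+ k) = pol_x a ^+ k.
Proof. exact: rmorphXn. Qed.

Lemma pol_x_nat k : pol_x k%:R = k%:R.
Proof. exact: rmorph_nat. Qed.

Lemma pol_x0 : pol_x 0 = 0.
Proof. exact: rmorph0. Qed.

Definition pol_xE := (pol_x0, pol_x_nat, pol_xC, pol_xX, pol_x_exp, pol_xB,
  pol_xD, pol_xM).

Lemma meval_pol_x a z s : (pol_x a).@[curve_pt c z s] = a.[z].
Proof.
elim/poly_ind: a => [|a k IH]; first by rewrite pol_x0 meval0 horner0.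
rewrite !pol_xE hornerD hornerM hornerX hornerC.
move: (pol_x a) IH => f IH.
rewrite /x /xvar !meval_ringE IH curve_pt_coord //= (mulrA c^-1) mulVf ?mul1r //.
Qed.

Definition normal_form f : Prop := exists a b,
  ideal_gen [set` curve_gens] (f - (pol_x a + pol_x b * s_poly)).

Lemma mem_gens k : (k < 6)%N -> ideal_gen [set` curve_gens] curve_gens`_k.
Proof. by move=> k6; apply: ideal_gen_sub; rewrite /= mem_nth. Qed.

Lemma normal_formD f g : normal_form f -> normal_form g -> normal_form (f + g).
Proof.
move=> [a [b Hf]] [a' [b' Hg]]; exists (a + a'), (b + b').
have := ideal_genD _ _ _ Hf Hg; congr (ideal_gen _ _).
by rewrite !pol_xE; ring.
Qed.

(** With normal forms N and N', f g - N N' = g (f - N) + N (g - N'). The s^2 in N N' is removed by b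
    b' times the second generator. *)
Lemma normal_formM f g : normal_form f -> normal_form g -> normal_form (f * g).
Proof.
move=> [a [b Hf]] [a' [b' Hg]].
exists (a * a' + b * b' * (5 * 'X ^+ 2 - 4)), (a * b' + a' * b).
have H := ideal_genD _ _ _ (ideal_genMl _ g _ Hf)
  (ideal_genMl _ (pol_x a + pol_x b * s_poly) _ Hg).
have := ideal_genD _ _ _ H (ideal_genMl _ (pol_x (b * b')) _ (mem_gens 1 isT)).
congr (ideal_gen _ _); rewrite /curve_gens /= !pol_xE; move: s_poly => S; ring.
Qed.

Lemma normal_formC k : normal_form k%:MP.
Proof.
exists k%:P, 0; rewrite pol_xC pol_x0 mul0r addr0 subrr.
exact: ideal_gen0.
Qed.

Lemma normal_formX i : normal_form 'X_i.
Proof.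
have cK : c%:MP * c^-1%:MP = 1 :> {mpoly K[7]} by rewrite -mpolyCM divff.
have t1 : (3 : {mpoly K[7]}) * 3^-1%:MP = 1.
  by rewrite -mpolyC_nat -mpolyCM divff ?pnatr_eq0 // mpolyC1.
have t2 : (2 : {mpoly K[7]}) * 2^-1%:MP = 1.
  by rewrite -mpolyC_nat -mpolyCM divff ?pnatr_eq0 // mpolyC1.
have X0 : normal_form (xvar K 1).
  exists (c%:P * 'X), 0; rewrite !pol_xE mul0r addr0 /x mulrA cK mul1r.
  by rewrite subrr; apply: ideal_gen0.
have X1 : normal_form (xvar K 2).
  exists (3 * 'X ^+ 2 - 1), 'X; have := mem_gens 0 isT.
  congr (ideal_gen _ _); rewrite /curve_gens /= !pol_xE /w.
  by move: s_poly => S; ring.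
have X6 : normal_form (xvar K 7).
  exists (c%:P * (18 * 'X ^+ 3 - 21 * 2^-1%:P * 'X)),
    (c%:P * (8 * 'X ^+ 2 - 3 * 2^-1%:P)).
  (* x7 = c r differs from its normal form by 8 c x times the first generator. *)
  have := ideal_genMl _ (c%:MP * (8 * x)) _ (mem_gens 0 isT).
  congr (ideal_gen _ _); rewrite /curve_gens /= !pol_xE.
  have eS : 3 * s_poly = - 12 * x ^+ 3 + 16 * x * w - 21 * x - 2 * r.
    by rewrite /s_poly mulrA t1 mul1r.
  have eX : xvar K 7 = c%:MP * r by rewrite /r mulrA cK mul1r.
  move: s_poly eS => S eS; rewrite eX.
  (* The constant 1/2 is opaque to ring arithmetic here, so the multiple of 1 - 2 (1/2) is split off
     as a summand of its own. *)
  transitivity (c%:MP * r - (c%:MP * (18 * x ^+ 3 - 21 * 2^-1%:MP * x) +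
    8 * c%:MP * x ^+ 2 * S - c%:MP * 2^-1%:MP * (3 * S)) +
    (1 - 2 * 2^-1%:MP) * (c%:MP * (8 * x * w - 6 * x ^+ 3 - r))).
    by rewrite eS /w; ring.
  by rewrite t2 subrr mul0r addr0; ring.
(* The generator of index k, for k from 2 to 5, equates variable k + 1 with variable 1 or 2. *)
have Xsub k l : (k < 6)%N -> curve_gens`_k = xvar K k.+1 - xvar K l ->
    normal_form (xvar K l) -> normal_form (xvar K k.+1).
  move=> k6 e [a [b Hl]]; exists a, b.
  have := ideal_genD _ _ _ Hl (mem_gens k k6).
  by congr (ideal_gen _ _); rewrite e; ring.
rewrite -(inord_val i); case: i => [[|[|[|[|[|[|[|?]]]]]]] ?] //=.
- exact: Xsub 2 1 _ _ _.
- exact: Xsub 3 2 _ _ _.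
- exact: Xsub 4 1 _ _ _.
- exact: Xsub 5 2 _ _ _.
Qed.

Lemma normal_formP f : normal_form f.
Proof.
elim/mpolyind: f => [|k m f _ _ IH]; first exact: normal_formC.
apply: normal_formD IH; rewrite -mul_mpolyC.
apply: normal_formM; first exact: normal_formC.
rewrite mpolyXE_id; elim/big_ind: _ => [|g h|i _].
- exact: (normal_formC 1).
- exact: normal_formM.
elim: (m i) => [|k' IH']; first exact: (normal_formC 1).
rewrite exprS; apply: normal_formM => //; exact: normal_formX.
Qed.

Lemma curve_gens_vanish f z s : s ^+ 2 = 5 * z ^+ 2 - 4 ->
  ideal_gen [set` curve_gens] f -> f.@[curve_pt c z s] = 0.
Proof.
move=> zs; apply: ideal_gen_vanish => g Hg.
have : curve c (curve_pt c z s) by exists z, s.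
by rewrite curve_zeros; apply.
Qed.

Lemma meval_normal_form f a b z s :
  s ^+ 2 = 5 * z ^+ 2 - 4 ->
  ideal_gen [set` curve_gens] (f - (pol_x a + pol_x b * s_poly)) ->
  f.@[curve_pt c z s] = a.[z] + b.[z] * s.
Proof.
move=> zs /(curve_gens_vanish _ _ _ zs) /eqP.
move: (pol_x a) (pol_x b) s_poly (meval_pol_x a z s)
  (meval_pol_x b z s) (meval_s_poly z s).
by move=> A B S <- <- eS; rewrite !meval_ringE eS subr_eq0 => /eqP.
Qed.

(** If f vanishes on the curve, its normal form vanishes on the hyperbola. Both coefficients are
    then 0, which leaves f itself in the ideal. *)
Lemma curve_gens_ideal : ideal_gen [set` curve_gens] = vanishing_ideal (curve c).
Proof.
apply/seteqP; split=> f.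
  by move=> Hf _ [z [s [zs ->]]]; apply: curve_gens_vanish.
move=> Hf; have [a [b Hab]] := normal_formP f.
have [|a0 b0] := @vanish_on_hyperbola K a b.
  move=> z s zs; rewrite -(meval_normal_form _ _ _ _ _ zs Hab).
  by apply: Hf; exists z, s.
by move: Hab; rewrite a0 b0 pol_x0 mul0r addr0 subr0.
Qed.

Lemma zclosed_curve : zclosed (curve c).
Proof. by rewrite curve_zeros; apply: zclosed_zeros. Qed.

(** The zeros of f on the curve have x among the roots of the norm of its normal form, and each such
    x carries at most two values of s. If the norm is 0, f vanishes on the whole curve. *)
Lemma curve_cofinite : cofinite_topology (curve c).
Proof.
split=> [l|f].
  pose pt (k : nat) : aff K 7 := curve_pt c k%:R (sqrtC (5 * k%:R ^+ 2 - 4)).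
  have pt_inj : injective pt.
    by move=> i j /(curve_pt_inj_x _ _ _ _ _ _ c0) /eqP; rewrite eqr_nat => /eqP.
  have [k kl] : exists k, pt k \notin l by exact: infinite_notin.
  exists (pt k) => //.
  by exists k%:R, (sqrtC (5 * k%:R ^+ 2 - 4)); rewrite sqrtCK.
have [a [b Hab]] := normal_formP f.
case: (eqVneq (pol_norm a b) 0) => [/pol_norm_eq0[a0 b0]|N0].
  left=> _ [z [s [zs ->]]].
  by rewrite (meval_normal_form _ _ _ _ _ zs Hab) a0 b0 !horner0 mul0r addr0.
have [rs Nrs] := closed_field_poly_normal (pol_norm a b).
right; exists [seq curve_pt c z (e * sqrtC (5 * z ^+ 2 - 4)) |
  z <- rs, e <- [:: 1; -1]].
move=> _ [z [s [zs ->]]]; rewrite (meval_normal_form _ _ _ _ _ zs Hab).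
move=> /(horner_pol_norm _ _ _ _ zs) /rootP.
rewrite Nrs rootZ ?lead_coef_eq0 // root_prod_XsubC => z_rs.
apply/allpairsP; set q := sqrtC (5 * z ^+ 2 - 4).
have : (s == q) || (s == - q) by rewrite -eqf_sqr sqrtCK zs.
case/orP => /eqP es; [exists (z, 1)|exists (z, -1)]; split=> //=.
- by rewrite !inE eqxx.
- by rewrite mul1r es.
- by rewrite !inE eqxx orbT.
- by rewrite mulN1r es.
Qed.

End Generators.

(** * Smoothness *)

Lemma mderiv_nat (F : comNzRingType) n (i : 'I_n) k :
  mderiv i (k%:R : {mpoly F[n]}) = 0.
Proof. by rewrite -mpolyC_nat mderivC. Qed.

Lemma mderiv_exp (F : comNzRingType) n (i : 'I_n) (f : {mpoly F[n]}) k :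
  mderiv i (f ^+ k.+1) = k.+1%:R * f ^+ k * mderiv i f.
Proof.
elim: k => [|k IH]; first by rewrite !expr1 expr0 mulr1 mul1r.
by rewrite exprS mderivM IH -[k.+2]addn1 natrD exprS; ring.
Qed.

Lemma meval_mderiv_xvar (K : fieldType) (p : aff K 7) j k : (j < 7)%N -> (k < 7)%N ->
  (mderiv (inord j) (xvar K k.+1)).@[p] = (k == j)%:R.
Proof.
move=> j7 k7; rewrite /xvar mderivX mnm1E mevalZ /= -val_eqE /= !inordK //.
case: eqP => [->|_]; last by rewrite mul0r.
by rewrite mul1r -[X in (X - _)%MM]add0m addmK mpolyX0 meval1.
Qed.

Definition mderiv_ringE := (@mderiv_nat, @mderivC, mderiv_exp, mderivB, mderivD,
  mderivN, mderivM).

Section Smooth.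
Context {K : numClosedFieldType} (c : K).
Hypothesis c0 : c != 0.

Lemma meval_mderiv_s_poly (p : aff K 7) j : (j < 7)%N ->
  (mderiv (inord j) (s_poly c)).@[p] =
  3^-1 * (16 * (c^-1 * p (inord 0)) * (1 == j)%N%:R - 2 * c^-1 * (6 == j)%N%:R +
   (0 == j)%N%:R * (- 36 * c^-1 * (c^-1 * p (inord 0)) ^+ 2 +
     16 * c^-1 * (p (inord 1) + 1) - 21 * c^-1)).
Proof.
move=> j7; rewrite /s_poly !mderiv_ringE.
rewrite !meval_ringE !meval_mderiv_xvar //.
rewrite /=.
move: (p _) (p _) (p _) (0 == j)%N%:R (1 == j)%N%:R (6 == j)%N%:R (c^-1).
move: (3^-1) => {j7} t y z q e0 e1 e6 d.
ring.
Qed.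

Lemma meval_mderiv_gens z s j : (j < 7)%N ->
  let e k : K := (k == j)%N%:R in
  let p := curve_pt c z s in
  let S := (mderiv (inord j) (s_poly c)).@[p] in
  [seq (mderiv (inord j) f).@[p] | f <- curve_gens c] =
  [:: e 1%N - 6 * z * c^-1 * e 0%N - c^-1 * e 0%N * s - z * S;
      2 * s * S - 10 * z * c^-1 * e 0%N;
      e 2 - e 0%N; e 3 - e 1%N; e 4 - e 0%N; e 5 - e 1%N].
Proof.
move=> j7 e p; have := meval_s_poly _ c0 z s; rewrite -/p.
have cz : c^-1 * (c * z) = z by rewrite mulrA mulVf ?mul1r.
rewrite /curve_gens; move: (s_poly c) => S eS /=.
by congr [:: _; _; _; _; _; _];
  rewrite !mderiv_ringE !meval_ringE !meval_mderiv_xvar //=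
  ?eS ?curve_pt_coord //= ?cz; rewrite -/(e 0%N) -/(e 1%N); ring.
Qed.

Lemma smooth_curve : smooth (curve c).
Proof.
exists 1%N, (curve_gens c); split.
- exact: cofinite_krull_dim (curve_cofinite _ c0) (zclosed_curve _ c0).
- exact: curve_gens_ideal.
(* The required rank 6 is full row rank: a row vector [v] annihilated by the Jacobian has to
   vanish. *)
move=> _ [z [s [zs ->]]]; apply/eqP; rewrite -[(7 - 1)%N]/(size (curve_gens c)).
apply: inj_row_free => v vJ.
pose u (k : nat) : K := v 0 (inord k : 'I_6).
have uE (i : 'I_6) : v 0 i = u i by rewrite /u inord_val.
have col j : (j < 7)%N -> \sum_(i < 6) u i *
    [seq (mderiv (inord j) f).@[curve_pt c z s] | f <- curve_gens c]`_i = 0.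
  move=> j7; have /rowP/(_ (inord j)) := vJ; rewrite !mxE => vj.
  rewrite -[RHS]vj; apply: eq_bigr => i _; rewrite mxE -uE.
  by rewrite (nth_map 0).
have cz : c^-1 * (c * z) = z by rewrite mulrA mulVf ?mul1r.
have := col 6 isT; have := col 5 isT; have := col 4 isT; have := col 3 isT.
have := col 2 isT; have := col 1%N isT; have := col 0%N isT.
rewrite !meval_mderiv_gens // !meval_mderiv_s_poly // !big_ord_recr !big_ord0.
rewrite !curve_pt_coord //= cz {col vJ}.
set S0 := (- 36 / c * _ + _ - _).
rewrite !(mulr0, mul0r, addr0, add0r, subr0, sub0r, mulr1, mul1r, mulrN1, oppr0).
move=> e0 e1 u2 u3 u4 u5 e6.
(* Column of x7, where only the multiples of the derivative of [s_poly] occur. *)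
have {}e6 : 2 * s * u 1%N = z * u 0%N.
  have k0 : 2 / (3 * c) != 0 by rewrite mulf_neq0 ?invr_eq0 ?mulf_neq0 ?pnatr_eq0.
  apply: (mulfI k0); apply/eqP; rewrite eq_sym -subr_eq0 -[X in _ == X]e6.
  by apply/eqP; field.
(* Column of x2, once [u 3] and [u 5] are 0; the relation just found cancels the terms with the
   derivative of [s_poly]. *)
have {}u0 : u 0%N = 0.
  rewrite u3 u5 in e1; rewrite -[RHS]e1.
  transitivity (u 0%N * (1 - z * (3^-1 * (16 * z))) +
    (z * u 0%N) * (3^-1 * (16 * z))); first by ring.
  by rewrite -e6; ring.
have su1 : s * u 1%N = 0.
  by apply: (@mulfI _ 2); rewrite ?pnatr_eq0 // mulrA e6 u0 !mulr0.
have zu1 : z * u 1%N = 0.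
  have k0 : - 10 / c != 0 by rewrite mulf_neq0 ?invr_eq0 // oppr_eq0 pnatr_eq0.
  apply: (mulfI k0); rewrite mulr0 -[RHS]e0 u0 u2 u4 /=.
  transitivity (- 10 / c * (z * u 1%N) + 2 * (s * u 1%N) * (3^-1 * S0)).
    by rewrite su1 mulr0 mul0r addr0.
  by ring.
(* The hyperbola is nonsingular: z and s cannot both vanish, as 5z^2 - s^2 = 4. *)
have u1 : u 1%N = 0.
  apply: (@mulfI _ 4); rewrite ?pnatr_eq0 // mulr0.
  transitivity (5 * z * (z * u 1%N) - s * (s * u 1%N)).
    by ring: zs.
  by rewrite su1 zu1 !mulr0 subrr.
apply/rowP => i; rewrite mxE.
rewrite (uE i); case: i => [[|[|[|[|[|[|?]]]]]] ?] //=.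
Qed.

End Smooth.

(** * Rationality *)

Section Rational.
Context {K : numClosedFieldType} (c : K).
Hypothesis c0 : c != 0.

Let q5 : K := sqrtC 5.

Let q5_neq0 : q5 != 0.
Proof. by rewrite sqrtC_eq0 pnatr_eq0. Qed.

Let q5_sqr : q5 ^+ 2 = 5.
Proof. exact: sqrtCK. Qed.

(* The asymptotes q5 x = s and q5 x = - s of the hyperbola give its
   parametrization by u = (q5 x + s) / 2, with 1 / u = (q5 x - s) / 2. *)
Definition of_curve (p : aff K 7) : aff K 1 :=
  [ffun _ => (q5 * (c^-1 * p (inord 0)) + (s_poly c).@[p]) / 2].

Definition to_curve (q : aff K 1) : aff K 7 :=
  curve_pt c ((q 0 + (q 0)^-1) / q5) (q 0 - (q 0)^-1).

Definition punctured_line : set (aff K 1) := [set q | q 0 != 0].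

Lemma of_curve_pt z s : of_curve (curve_pt c z s) 0 = (q5 * z + s) / 2.
Proof.
by rewrite ffunE meval_s_poly // curve_pt_coord //= (mulrA c^-1) mulVf ?mul1r.
Qed.

Lemma asymptotes z s : s ^+ 2 = 5 * z ^+ 2 - 4 ->
  (q5 * z + s) / 2 * ((q5 * z - s) / 2) = 1.
Proof.
move=> zs; transitivity ((q5 ^+ 2 * z ^+ 2 - s ^+ 2) / 4); first by field.
by rewrite q5_sqr zs; field.
Qed.

Lemma of_curve_regular : regular_map (curve c) punctured_line of_curve.
Proof.
split=> [_ [z [s [/asymptotes zs ->]]]|i].
  rewrite /punctured_line /= of_curve_pt; apply/eqP => u0.
  by move/eqP: zs; rewrite u0 mul0r eq_sym oner_eq0.
apply: rational_regular.
exists (2^-1%:MP * (q5%:MP * (c^-1%:MP * xvar K 1) + s_poly c)), 1 => p _.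
rewrite meval1 oner_neq0 ffunE divr1; split=> //.
move: (s_poly c) => S; rewrite /xvar !meval_ringE /=; ring.
Qed.

Lemma to_curve_regular : regular_map punctured_line (curve c) to_curve.
Proof.
split=> [q /= q0|i].
  exists ((q 0 + (q 0)^-1) / q5), (q 0 - (q 0)^-1); split=> //.
  rewrite exprMn exprVn q5_sqr; field.
  by rewrite q0.
apply: rational_regular.
(* The coordinates have degree at most 3 in x and s, so [u ^+ 3] is a common denominator; [fx],
   [fy], [fr] are the numerators. *)
pose u : {mpoly K[1]} := 'X_0; pose t : {mpoly K[1]} := q5^-1%:MP.
pose h : {mpoly K[1]} := 2^-1%:MP.
pose fx : {mpoly K[1]} := c%:MP * t * (u ^+ 2 + 1) * u ^+ 2.
pose fy := 3 * t ^+ 2 * (u ^+ 2 + 1) ^+ 2 * u +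
  t * (u ^+ 2 + 1) * (u ^+ 2 - 1) * u - u ^+ 3.
pose fr := c%:MP * (18 * t ^+ 3 * (u ^+ 2 + 1) ^+ 3 +
  8 * t ^+ 2 * (u ^+ 2 + 1) ^+ 2 * (u ^+ 2 - 1) -
  21 * h * t * (u ^+ 2 + 1) * u ^+ 2 - 3 * h * (u ^+ 2 - 1) * u ^+ 2).
exists ([:: fx; fy; fx; fy; fx; fy; fr]`_i), (u ^+ 3) => q.
rewrite /punctured_line /= => q0.
rewrite /u meval_exp mevalXU expf_neq0 //; split=> //.
rewrite /to_curve ffunE.
have fxE : c * ((q 0 + (q 0)^-1) / q5) = fx.@[q] / q 0 ^+ 3.
  by rewrite /fx /t /u !meval_ringE; field; rewrite q0.
have fyE : y_of ((q 0 + (q 0)^-1) / q5) (q 0 - (q 0)^-1) = fy.@[q] / q 0 ^+ 3.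
  by rewrite /fy /t /u !meval_ringE /y_of; field; rewrite q0.
have frE : c * r_of ((q 0 + (q 0)^-1) / q5) (q 0 - (q 0)^-1) = fr.@[q] / q 0 ^+ 3.
  by rewrite /fr /t /u /h !meval_ringE /r_of; field; rewrite q0.
by case: i => [[|[|[|[|[|[|[|?]]]]]]] ?].
Qed.

Lemma rational_curve_curve : rational_curve (curve c).
Proof.
have cof := curve_cofinite _ c0; have clo := zclosed_curve _ c0.
split=> //; [exact: cofinite_irreducible|exact: cofinite_krull_dim|].
have openT n : zopen [set: aff K n] by rewrite /zopen setCT; apply: zclosed0.
(* The isomorphism uses the whole curve; from the line only the point 0 is removed. *)
exists (curve c), punctured_line, of_curve, to_curve; split.
- split; first by have [p ? _] := cof.1 [::]; exists p.
  by exists setT; rewrite setIT.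
- split; first by exists [ffun=> 1]; rewrite /punctured_line /= ffunE oner_eq0.
  exists punctured_line; rewrite setTI; split=> //.
  exists [set 'X_0]; apply/seteqP; split=> q /=.
    by move=> /negP; rewrite negbK => /eqP q0 _ ->; rewrite mevalXU.
  by move=> /(_ _ erefl); rewrite mevalXU => q0; rewrite /punctured_line /= q0 eqxx.
- exact: of_curve_regular.
- exact: to_curve_regular.
split=> [_ [z [s [zs ->]]]|q q0].
  rewrite /to_curve of_curve_pt.
  have u0 : (q5 * z + s) / 2 != 0.
    apply/eqP => u0; move/eqP: (asymptotes _ _ zs).
    by rewrite u0 mul0r eq_sym oner_eq0.
  have -> : ((q5 * z + s) / 2)^-1 = (q5 * z - s) / 2.
    by apply: (mulfI u0); rewrite mulfV // asymptotes.
  by congr curve_pt; field.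
apply/ffunP => i; rewrite ord1 /to_curve of_curve_pt; field.
by rewrite q5_neq0 andbT; exact: q0.
Qed.

End Rational.

(** * Lexicographic leading monomials *)

Section LeadingMonomials.
Context {F : fieldType}.
Implicit Types (f g : {mpoly F[7]}) (d : nat -> nat) (e : seq nat) (m : 'X_{1..7}).

(** Bounds on the degree in each variable separately can be computed along the syntax of a
    polynomial and suffice for the lexicographic comparisons. *)
Definition degs_le d f : Prop := forall m, m \in msupp f -> forall i, (m i <= d i)%N.

Lemma degs_le_weaken d (e : nat -> nat) f :
  degs_le d f -> (forall i, (i < 7)%N -> (d i <= e i)%N) -> degs_le e f.
Proof. by move=> df de m mf i; apply: leq_trans (df m mf i) (de _ _). Qed.

Lemma degs_leD d (e : nat -> nat) f g : degs_le d f -> degs_le e g ->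
  degs_le (fun i => maxn (d i) (e i)) (f + g).
Proof.
move=> df eg m /msuppD_le; rewrite mem_cat.
by case/orP => [/df|/eg] H i; rewrite leq_max H ?orbT.
Qed.

Lemma degs_leN d f : degs_le d f -> degs_le d (- f).
Proof. by move=> df m; rewrite (perm_mem (msuppN f)); apply: df. Qed.

Lemma degs_leM d (e : nat -> nat) f g : degs_le d f -> degs_le e g ->
  degs_le (fun i => d i + e i)%N (f * g).
Proof.
move=> df eg m /msuppM_le /allpairsP[[m1 m2] [/= m1f m2g ->]] i.
by rewrite mnmDE leq_add // (df, eg).
Qed.

Lemma degs_le_nat k : degs_le (fun=> 0%N) (k%:R : {mpoly F[7]}).
Proof.
rewrite -mpolyC1 -mpolyCMn => m; rewrite msuppC; case: ifP => // _.
by rewrite inE => /eqP-> i; rewrite mnm0E.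
Qed.

Lemma degs_leX d f k : degs_le d f -> degs_le (fun i => k * d i)%N (f ^+ k).
Proof.
move=> df; elim: k => [|k IH]; first exact: degs_le_nat 1.
by rewrite exprS => m mf i; rewrite mulSn; apply: (degs_leM _ _ _ _ df IH).
Qed.

Lemma degs_le_xvar k : (0 < k < 8)%N -> degs_le (fun i => i.+1 == k) (xvar F k).
Proof.
case: k => // k k7 m; rewrite /xvar msuppX inE => /eqP-> i.
by rewrite mnm1E -val_eqE /= inordK // eqSS eq_sym.
Qed.

(** Lists may have fewer than 7 entries: the default of [nth] supplies zero exponents. *)
Definition mon (e : seq nat) : 'X_{1..7} := [multinom nth 0%N e i | i < 7].

Lemma monE e (i : 'I_7) : mon e i = nth 0%N e i.
Proof. by rewrite mnmE. Qed.

Lemma mpolyX_mon (e : seq nat) :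
  'X_[mon e] = \prod_(i < 7) xvar F i.+1 ^+ nth 0%N e i.
Proof.
rewrite mpolyXE_id; apply: eq_bigr => i _.
by rewrite monE /xvar inord_val.
Qed.

(** The largest index where [m] and [mon e] differ is at least [k], and there the bound [d] makes
    [m] the smaller. *)
Lemma lex_lt_degs k d e m : (k < 7)%N -> (d k < nth 0%N e k)%N ->
  (forall j, (k < j < 7)%N -> (d j <= nth 0%N e j)%N) ->
  (forall i, (m i <= d i)%N) -> lex_lt m (mon e).
Proof.
move=> k7 dk dj md.
pose P (i : 'I_7) := m i != mon e i.
have Pk : P (Ordinal k7).
  rewrite /P neq_ltn monE; apply/orP; left.
  exact: leq_ltn_trans (md (Ordinal k7)) dk.
case: (arg_maxnP (fun i : 'I_7 => i : nat) Pk) => i Pi imax.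
have ki : (k <= i)%N := imax _ Pk.
apply/existsP; exists i; apply/andP; split.
  rewrite ltn_neqAle [X in X && _]Pi monE /=.
  move: ki; rewrite leq_eqVlt => /orP[/eqP ki|ki].
    by rewrite -ki; apply: leq_trans (ltnW dk); rewrite ki; apply: md.
  by apply: leq_trans (md i) (dj _ _); rewrite ki ltn_ord.
apply/forallP => j; apply/implyP => ij; apply: contraLR ij => Pj.
by rewrite -leqNgt; apply: imax.
Qed.

Lemma lex_ltxx m : lex_lt m m = false.
Proof. by apply/negbTE/existsP; case=> i; rewrite ltnn. Qed.

Lemma lead_monomial_intro k m g f : k%:R != 0 :> F ->
  f = k%:R * 'X_[m] + g -> (forall m', m' \in msupp g -> lex_lt m' m) ->
  lead_monomial (@lex_lt 7) f m.
Proof.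
move=> k0 -> gm; have mg : m \notin msupp g.
  by apply/negP => /gm; rewrite lex_ltxx.
have kE : (k%:R : {mpoly F[7]}) * 'X_[m] = k%:R *: 'X_[m].
  by rewrite -mul_mpolyC mpolyC_nat.
rewrite kE; split.
  by rewrite mcoeff_msupp mcoeffD mcoeffZ mcoeffX eqxx mulr1 (memN_msupp_eq0 mg) addr0.
move=> m' /msuppD_le; rewrite mem_cat => /orP[|/gm]; last by right.
by move=> /msuppZ_le; rewrite msuppX inE => /eqP; left.
Qed.

Lemma lead_monomial_degs k j d e g f : k%:R != 0 :> F ->
  f = k%:R * 'X_[mon e] + g -> degs_le d g ->
  (j < 7)%N -> (d j < nth 0%N e j)%N ->
  (forall i, (j < i < 7)%N -> (d i <= nth 0%N e i)%N) ->
  lead_monomial (@lex_lt 7) f (mon e).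
Proof.
move=> k0 fE dg j7 dj di; apply: lead_monomial_intro k0 fE _ => m' /dg md.
exact: lex_lt_degs j7 dj di md.
Qed.

End LeadingMonomials.

(** * Groebner bases *)

Section Groebner.
Context {K : numClosedFieldType} (c : K).
Hypothesis c0 : c != 0.
Implicit Types (f : {mpoly K[7]}) (m : 'X_{1..7}).

(* x2^2, x1 x7, x2 x7, x3, x4, x5, x6, x7^2. *)
Definition initial_exponents : seq (seq nat) :=
  [:: [:: 0; 2]; [:: 1; 0; 0; 0; 0; 0; 1]; [:: 0; 1; 0; 0; 0; 0; 1];
      [:: 0; 0; 1]; [:: 0; 0; 0; 1]; [:: 0; 0; 0; 0; 1];
      [:: 0; 0; 0; 0; 0; 1]; [:: 0; 0; 0; 0; 0; 0; 2]]%N.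

Lemma standard_monomial m :
  (forall e, e \in initial_exponents -> ~~ (mon e <= m)%MM) ->
  (forall i : 'I_7, (1 < i < 6)%N -> m i = 0%N) /\
  ((m (inord 1) <= 1)%N /\ m (inord 6) = 0%N \/
   (forall i : 'I_7, i != 6%N :> nat -> m i = 0%N) /\ m (inord 6) = 1%N).
Proof.
move=> nd.
(* Non-divisibility gives a position where [m] is below [e]. It must carry a nonzero exponent of
   [e], so for a pure power it is known. *)
have nz e : e \in initial_exponents ->
    exists2 k, (k < 7)%N & (m (inord k) < nth 0%N e k)%N.
  move=> /nd /mnm_lepP /existsNP[i /negP]; rewrite -ltnNge monE => mi.
  by exists i => //; rewrite inord_val.
have m1 : (m (inord 1) <= 1)%N.
  have [|[|[|[|[|[|[|[|?]]]]]]] //] := nz [:: 0; 2]%N _.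
  by rewrite !inE.
have mk k : (1 < k < 6)%N -> m (inord k) = 0%N.
  case: k => [|[|[|[|[|[|?]]]]]] // _; apply/eqP; rewrite -leqn0.
  - have [|[|[|[|[|[|[|[|?]]]]]]] //] := nz [:: 0; 0; 1]%N _.
    by rewrite !inE.
  - have [|[|[|[|[|[|[|[|?]]]]]]] //] := nz [:: 0; 0; 0; 1]%N _.
    by rewrite !inE.
  - have [|[|[|[|[|[|[|[|?]]]]]]] //] := nz [:: 0; 0; 0; 0; 1]%N _.
    by rewrite !inE.
  - have [|[|[|[|[|[|[|[|?]]]]]]] //] := nz [:: 0; 0; 0; 0; 0; 1]%N _.
    by rewrite !inE.
have m6 : (m (inord 6) <= 1)%N.
  have [|[|[|[|[|[|[|[|?]]]]]]] //] := nz [:: 0; 0; 0; 0; 0; 0; 2]%N _.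
  by rewrite !inE.
split=> [i i16|]; first by rewrite -(inord_val i) mk.
move: m6; rewrite leq_eqVlt ltnS leqn0 => /orP[/eqP m6|/eqP m6]; last by left.
right; split=> // i i6.
have m0 : m (inord 0) = 0%N.
  have [|[|[|[|[|[|[|[|?]]]]]]] //=] := nz [:: 1; 0; 0; 0; 0; 0; 1]%N _.
  - by rewrite !inE.
  - by case: (m (inord 0)).
  - by rewrite m6.
have {}m1 : m (inord 1) = 0%N.
  have [|[|[|[|[|[|[|[|?]]]]]]] //=] := nz [:: 0; 1; 0; 0; 0; 0; 1]%N _.
  - by rewrite !inE.
  - by case: (m (inord 1)).
  - by rewrite m6.
rewrite -(inord_val i); move: i6.
by case: i => [[|[|[|[|[|[|[|?]]]]]]] ?] //= _; rewrite ?m0 ?m1 ?mk.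
Qed.

(* x7 is not a polynomial in x1, ..., x6 on the curve: the latter take the same
   values at the two points with x1 = 0, whereas x7 does not. *)
Lemma lead_monomial_neq_x7 f m :
  vanishing_ideal (curve c) f -> lead_monomial (@lex_lt 7) f m ->
  (forall i : 'I_7, i != 6%N :> nat -> m i = 0%N) -> m (inord 6) = 1%N -> False.
Proof.
move=> fI [mf mlead] m06 m6.
(* Here [m] is x7, and the monomials below x7 are exactly those free of x7. *)
have lower m' : m' \in msupp f -> m' != m -> m' (inord 6) = 0%N.
  move=> m'f m'm; case: (mlead _ m'f) => [e|]; first by rewrite e eqxx in m'm.
  case/existsP => i /andP[mi _]; have i6 : i = inord 6.
    apply: val_inj; rewrite /= inordK //; apply: contraTeq mi => i6.
    by rewrite m06.
  by move: mi; rewrite i6 m6 ltnS leqn0 => /eqP.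
pose P s : aff K 7 := curve_pt c 0 s.
have val s : f.@[P s] = f@_m * (c * (- (3 / 2) * s)) +
    \sum_(m' <- msupp f | m' != m) f@_m' * \prod_(i | i != inord 6) P 0 i ^+ m' i.
  rewrite mevalE (bigD1_seq m) ?msupp_uniq //=; congr (f@_m * _ + _).
    rewrite (bigD1 (inord 6)) //= m6 big1 => [|i i6]; last first.
      rewrite m06 ?expr0 //; apply: contra i6 => /eqP i6.
      by apply/eqP/val_inj; rewrite /= inordK.
    by rewrite curve_pt_coord //= mulr1 /r_of; ring.
  rewrite big_seq_cond [RHS]big_seq_cond; apply: eq_bigr => m' /andP[m'f m'm].
  congr (_ * _); rewrite (bigD1 (inord 6)) //= lower // expr0 mul1r.
  apply: eq_bigr => i i6; congr (_ ^+ _); rewrite /P !ffunE.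
  move: i6; rewrite -val_eqE /= inordK //.
  by case: i => [[|[|[|[|[|[|[|?]]]]]]] ?] //= _; rewrite /y_of !mul0r.
have f0 s : s ^+ 2 = - 4 -> f.@[P s] = 0.
  by move=> s4; apply: fI; exists 0, s; rewrite s4 expr0n /= mulr0 sub0r.
pose s : K := sqrtC (- 4); have s4 : s ^+ 2 = - 4 by rewrite sqrtCK.
have s0 : s != 0 by rewrite sqrtC_eq0 oppr_eq0 pnatr_eq0.
have /eqP : f@_m * (c * (3 * s)) = 0.
  have := f0 _ s4; have := f0 (- s); rewrite sqrrN => /(_ s4).
  rewrite !val; move: (\sum_(_ <- _ | _) _) => S e1 e2.
  by rewrite -(subrr 0) -[X in X - _]e1 -[X in _ - X]e2; field.
rewrite mulf_eq0 -[_ == 0]negbK -mcoeff_msupp mf /=.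
by rewrite !mulf_eq0 (negPf c0) (negPf s0) pnatr_eq0.
Qed.

(** For [f] in x1 and x2 only, the coefficient of x2^e as a polynomial in x; the powers of [c] come
    from x1 = c x. *)
Definition x1_part (e : nat) f : {poly K} :=
  \sum_(m <- msupp f | m (inord 1) == e)
    (f@_m * c ^+ m (inord 0)) *: 'X^(m (inord 0)).

Definition linear_x2 f : Prop := forall m, m \in msupp f ->
  (m (inord 1) <= 1)%N /\ forall i : 'I_7, (1 < i)%N -> m i = 0%N.

Lemma meval_linear_x2 f z s : linear_x2 f ->
  f.@[curve_pt c z s] = (x1_part 0 f).[z] + (x1_part 1 f).[z] * y_of z s.
Proof.
move=> fl; have mevalm m : m \in msupp f ->
    f@_m * \prod_i curve_pt c z s i ^+ m i =
    ((f@_m * c ^+ m (inord 0)) *: 'X^(m (inord 0))).[z] * y_of z s ^+ m (inord 1).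
  case/fl => _ m2; rewrite (bigD1 (inord 0)) //= (bigD1 (inord 1)) /=; last first.
    by rewrite -val_eqE /= !inordK.
  rewrite big1 => [|i /andP[i0 i1]]; last first.
    rewrite m2 ?expr0 //; move: i0 i1; rewrite -!val_eqE /= !inordK //.
    by case: (nat_of_ord i) => [|[|]].
  by rewrite mulr1 !curve_pt_coord //= hornerZ hornerXn exprMn !mulrA.
rewrite mevalE (bigID (fun m : 'X_{1..7} => m (inord 1) == 0%N)) /=.
rewrite /x1_part !horner_sum mulr_suml; congr (_ + _).
  rewrite big_seq_cond [RHS]big_seq_cond; apply: eq_bigr => m /andP[mf /eqP m1].
  by rewrite mevalm // m1 mulr1.
rewrite big_seq_cond [RHS]big_seq_cond; apply: eq_big => m.
  case: (boolP (m \in msupp f)) => //= /fl[].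
  by case: (m (inord 1)) => [|[|]].
case/andP => mf m1; rewrite mevalm //; congr (_ * _).
by case: (m (inord 1)) m1 (fl _ mf).1 => [|[|]].
Qed.

(** No cancellation occurs: monomials with equal x2-exponent differ in their x1-exponent. *)
Lemma x1_part_neq0 f m : linear_x2 f -> m \in msupp f ->
  x1_part (m (inord 1)) f != 0.
Proof.
move=> fl mf; apply/eqP => /(congr1 (fun p : {poly K} => p`_(m (inord 0)))) /eqP.
rewrite coef0 /x1_part coef_sum big_mkcond (bigD1_seq m) ?msupp_uniq //=.
rewrite eqxx big1_seq => [|m'].
  rewrite coefZ coefXn eqxx mulr1 addr0 mulf_eq0 expf_eq0 (negPf c0) andbF orbF.
  by apply/negP; rewrite -mcoeff_msupp.
case/andP => m'm m'f; case: eqP => // m1; rewrite coefZ coefXn.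
case: eqP => [m0|]; last by rewrite mulr0.
case/eqP: m'm; apply/mnmP => i; rewrite -(inord_val i).
have [_ m2] := fl _ mf; have [_ m'2] := fl _ m'f.
case: i => [[|[|k]] k7] //=.
by rewrite m2 ?m'2 ?inordK.
Qed.

(** Substituting y = 3x^2 - 1 + x s turns a0 + a1 y into (a0 + a1 (3x^2 - 1)) + (a1 x) s. If this
    vanishes on the hyperbola, then a1 = 0 and hence a0 = 0. *)
Lemma linear_x2_notin_ideal f m : vanishing_ideal (curve c) f -> linear_x2 f ->
  m \notin msupp f.
Proof.
move=> fI fl; apply/negP => mf; have := x1_part_neq0 _ _ fl mf.
have [|a0 /eqP] := @vanish_on_hyperbola K
    (x1_part 0 f + x1_part 1 f * (3%:P * 'X ^+ 2 - 1%:P)) (x1_part 1 f * 'X).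
  move=> z s zs; have := fI _ (ex_intro _ z (ex_intro _ s (conj zs erefl))).
  rewrite meval_linear_x2 // => <-.
  rewrite !(hornerD, hornerN, hornerM, hornerXn, horner_exp, hornerX, hornerC).
  by rewrite /y_of; ring.
rewrite mulf_eq0 polyX_eq0 orbF => /eqP b0.
move: a0; rewrite b0 mul0r addr0 => a0.
have := (fl _ mf).1; case: (m (inord 1)) => [|[|]] // _.
  by rewrite a0 eqxx.
by rewrite b0 eqxx.
Qed.

Lemma initial_exponents_divide f m :
  vanishing_ideal (curve c) f -> lead_monomial (@lex_lt 7) f m ->
  exists2 e, e \in initial_exponents & (mon e <= m)%MM.
Proof.
move=> fI fm; apply: contrapT => /forall2NP nd.
have [e eI|m2 []] := standard_monomial m.
- by apply/negP; case: (nd e).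
- case=> m1 m6; have [mf mlead] := fm.
  suff fl : linear_x2 f.
    by move: mf; rewrite (negPf (linear_x2_notin_ideal _ _ fI fl)).
  move=> m' m'f.
  (* As [m] involves only x1 and x2, a comparison with a lower [m'] is decided at x1 or x2, and the
     exponents beyond agree. So [m'] is also of degree at most 1 in x2 and free of x3, ..., x7. *)
  have m16 (i : 'I_7) : (1 < i)%N -> m i = 0%N.
    move=> i1; case: (ltnP i 6) => i6; first by rewrite m2 // i1.
    rewrite (_ : i = inord 6) //; apply/val_inj; rewrite /= inordK //.
    by apply/eqP; rewrite eqn_leq i6 -ltnS ltn_ord.
  have [->//|/existsP[i /andP[mi /forallP mj]]] := mlead _ m'f.
  have i1 : (i <= 1)%N by rewrite leqNgt; apply: contraTN mi => /m16 ->.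
  have m'E (j : 'I_7) : (i < j)%N -> m' j = m j.
    by move=> ij; apply/eqP; move: (mj j); rewrite ij.
  split=> [|j j1]; last by rewrite m'E ?m16 // (leq_ltn_trans i1).
  have := i1; rewrite leq_eqVlt => /orP[/eqP i1'|i0].
    have e : i = inord 1 by apply: val_inj; rewrite /= inordK.
    by rewrite -e (leq_trans (ltnW mi)) // e.
  by rewrite m'E ?inordK.
- by case=> m06 m6; apply: lead_monomial_neq_x7 fI fm m06 m6.
Qed.

(** No S-polynomials are needed: every leading monomial of the ideal is divisible by one of the
    eight, so every leading term is a multiple of one from [G]. *)
Lemma groebner_curve (G : seq {mpoly K[7]}) :
  [set` G] `<=` vanishing_ideal (curve c) ->
  (forall e, e \in initial_exponents ->
    exists2 g, g \in G & lead_monomial (@lex_lt 7) g (mon e)) ->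
  groebner_basis (@lex_lt 7) (vanishing_ideal (curve c)) G.
Proof.
move=> GI Glead; split=> //; apply/seteqP; split.
  by apply: ideal_genP => _ [f [m [/GI fI fm ->]]]; exists f, m.
apply: ideal_gen_idem => _ [f [m [fI fm ->]]].
have [e /Glead[g gG gm] em] := initial_exponents_divide _ _ fI fm.
have g0 : g@_(mon e) != 0 by rewrite -mcoeff_msupp; case: gm.
have -> : f@_m *: 'X_[m] =
    ((f@_m / g@_(mon e)) *: 'X_[m - mon e]) * (g@_(mon e) *: 'X_[mon e]).
  by rewrite -scalerAl -scalerAr scalerA divfK // -mpolyXD submK.
by apply/ideal_genMl/ideal_gen_sub; exists g, (mon e).
Qed.

End Groebner.

(** * The two explicit bases *)

Section Bases.
Context {K : numClosedFieldType}.
Implicit Types f g : {mpoly K[7]}.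
Local Notation x k := (xvar K k).

Lemma monX (e : seq nat) : 'X_[mon e] =
  x 1 ^+ nth 0%N e 0 * x 2 ^+ nth 0%N e 1 * x 3 ^+ nth 0%N e 2 *
  x 4 ^+ nth 0%N e 3 * x 5 ^+ nth 0%N e 4 * x 6 ^+ nth 0%N e 5 *
  x 7 ^+ nth 0%N e 6.
Proof. by rewrite mpolyX_mon !big_ord_recr big_ord0 /= mul1r. Qed.

(* A basis element minus its leading term has degree at most 1 in x2 and 0 in
   x3, ..., x7, up to a multiple of x7 in the third one; the bound on the degree
   in x1 only has to be large. *)
Let ten_x1_x2 (i : nat) : nat := nth 0%N [:: 10; 1]%N i.

(** The degree bound is synthesized along the shape of the polynomial; [degs] then compares it with
    the required one at the seven indices. *)
Ltac degs_rec := lazymatch goal with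
  | |- degs_le _ (_ + _) => eapply degs_leD; degs_rec
  | |- degs_le _ (- _) => eapply degs_leN; degs_rec
  | |- degs_le _ (_ * _) => eapply degs_leM; degs_rec
  | |- degs_le _ (_ ^+ _) => eapply degs_leX; degs_rec
  | |- degs_le _ (xvar _ _) => eapply degs_le_xvar; exact isT
  | |- degs_le _ 1 => exact: (degs_le_nat 1)
  | |- degs_le _ (_ %:R) => eapply degs_le_nat
  end.

Ltac degs := eapply degs_le_weaken; [ degs_rec
  | by case=> [|[|[|[|[|[|[|?]]]]]]] ].

(** [k] is the leading coefficient, [g] the rest of the polynomial, and [j] the index of the
    variable that decides the comparison. *)
Ltac lead k j g := apply: (@lead_monomial_degs _ k j ten_x1_x2 _ g);
  [ by rewrite ?oner_neq0 ?pnatr_eq0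
  | by rewrite monX /=; ring | degs
  | by [] | by [] | by case=> [|[|[|[|[|[|[|?]]]]]]] ].

(** Two comparisons are needed: x7 is below x2 x7 because of x2, the terms of [g] because of x7. *)
Lemma below_x2_x7 k g : degs_le ten_x1_x2 g ->
  forall m, m \in msupp (k%:R * x 7 + g) ->
  lex_lt m (mon [:: 0; 1; 0; 0; 0; 0; 1]%N).
Proof.
move=> dg m /msuppD_le; rewrite mem_cat => /orP[mx7|/dg mg].
  have /(_ _ mx7) := degs_leM _ _ _ _ (@degs_le_nat K k) (@degs_le_xvar K 7 isT).
  move=> mx; apply: (lex_lt_degs 1 (fun i => i.+1 == 7)%N _ _ _ _ _ mx) => //.
  by case=> [|[|[|[|[|[|[|?]]]]]]].
apply: (lex_lt_degs 6 ten_x1_x2 _ _ _ _ _ mg) => //.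
by case=> [|[|[|[|[|[|[|?]]]]]]].
Qed.

Lemma h_basis_lead e : e \in initial_exponents ->
  exists2 g, g \in h_basis K & lead_monomial (@lex_lt 7) g (mon e).
Proof.
have mem i : (i < 8)%N -> (h_basis K)`_i \in h_basis K.
  by exact: (@mem_nth _ 0 (h_basis K) i).
rewrite !inE; do !case/orP; move/eqP => ->.
- exists (h_basis K)`_0; first exact: mem.
  lead 1%N 1%N (2 * x 1 ^+ 2 * (2 * x 1 ^+ 2 - 3 * x 2 - 1) + 2 * x 2 + 1).
- exists (h_basis K)`_1; first exact: mem.
  lead 2%N 6%N (4 * x 1 ^+ 2 * (3 * x 1 ^+ 2 - 4 * x 2 - 1) + 3 * (x 2 + 1)).
- exists (h_basis K)`_2; first exact: mem.
  apply: (@lead_monomial_intro _ 1%N _ (1%:R * x 7 +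
    (x 1 ^+ 3 * (32 * x 1 ^+ 2 - 42 * x 2 - 16) + x 1 * (15 * x 2 + 9)))).
  + by rewrite ?oner_neq0 ?pnatr_eq0.
  + by rewrite monX /=; ring.
  by apply: below_x2_x7; degs.
- exists (h_basis K)`_3; first exact: mem.
  lead 1%N 2%N (- x 1).
- exists (h_basis K)`_4; first exact: mem.
  lead 1%N 3%N (- x 2).
- exists (h_basis K)`_5; first exact: mem.
  lead 1%N 4%N (- x 1).
- exists (h_basis K)`_6; first exact: mem.
  lead 1%N 5%N (- x 2).
- exists (h_basis K)`_7; first exact: mem.
  lead 2%N 6%N (x 1 ^+ 4 * (440 * x 1 ^+ 2 - 576 * x 2 - 400)
    + x 1 ^+ 2 * (444 * x 2 + 198) - 63 * x 2 - 45).
Qed.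

Lemma g_basis_lead e : e \in initial_exponents ->
  exists2 g, g \in g_basis K & lead_monomial (@lex_lt 7) g (mon e).
Proof.
have mem i : (i < 8)%N -> (g_basis K)`_i \in g_basis K.
  by exact: (@mem_nth _ 0 (g_basis K) i).
rewrite !inE; do !case/orP; move/eqP => ->.
- exists (g_basis K)`_0; first exact: mem.
  lead 4%N 1%N (x 1 ^+ 2 * (x 1 ^+ 2 - 6 * x 2 - 2) + 8 * x 2 + 4).
- exists (g_basis K)`_1; first exact: mem.
  lead 2%N 6%N (x 1 ^+ 2 * (3 * x 1 ^+ 2 - 16 * x 2 - 4) + 12 * (x 2 + 1)).
- exists (g_basis K)`_2; first exact: mem.
  apply: (@lead_monomial_intro _ 2%N _ (2 * x 7 +
    (x 1 ^+ 3 * (4 * x 1 ^+ 2 - 21 * x 2 - 8) + x 1 * (30 * x 2 + 18)))).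
  + by rewrite ?oner_neq0 ?pnatr_eq0.
  + by rewrite monX /=; ring.
  by apply: below_x2_x7; degs.
- exists (g_basis K)`_3; first exact: mem.
  lead 1%N 2%N (- x 1).
- exists (g_basis K)`_4; first exact: mem.
  lead 1%N 3%N (- x 2).
- exists (g_basis K)`_5; first exact: mem.
  lead 1%N 4%N (- x 1).
- exists (g_basis K)`_6; first exact: mem.
  lead 1%N 5%N (- x 2).
- exists (g_basis K)`_7; first exact: mem.
  lead 4%N 6%N (x 1 ^+ 4 * (55 * x 1 ^+ 2 - 288 * x 2 - 200)
    + x 1 ^+ 2 * (888 * x 2 + 396) - 504 * x 2 - 360).
Qed.

Lemma h_basis_vanish : [set` h_basis K] `<=` vanishing_ideal (curve (1 : K)).
Proof.
move=> f; rewrite /= !inE => fG _ [z [s [zs ->]]]; move: fG.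
do !case/orP; move/eqP=> ->;
  rewrite /xvar !meval_ringE ?curve_pt_coord //= ?subrr // /y_of /r_of; by field: zs.
Qed.

Lemma g_basis_vanish : [set` g_basis K] `<=` vanishing_ideal (curve (2 : K)).
Proof.
move=> f; rewrite /= !inE => fG _ [z [s [zs ->]]]; move: fG.
do !case/orP; move/eqP=> ->;
  rewrite /xvar !meval_ringE ?curve_pt_coord //= ?subrr // /y_of /r_of; by field: zs.
Qed.

End Bases.

(** * The frieze variety *)

Lemma rmorph_curve_pt (F E : fieldType) (f : {rmorphism F -> E}) (c x s : F)
    (i : 'I_7) : f (curve_pt c x s i) = curve_pt (f c) (f x) (f s) i.
Proof.
have fy : f (y_of x s) = y_of (f x) (f s).
  by rewrite rmorphB rmorphD !(rmorphXn, rmorphM) rmorph1 rmorph_nat.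
have fr : f (r_of x s) = r_of (f x) (f s).
  by rewrite !rmorphB rmorphD !(rmorphXn, rmorphM) !fmorphV !rmorph_nat.
rewrite !ffunE; case: i => [[|[|[|[|[|[|[|?]]]]]]] ?] //=; by rewrite rmorphM ?fr.
Qed.

Section FriezeVariety.
Context {K : numClosedFieldType}.

Lemma frieze_pointE t : frieze_point K t =
  curve_pt (ratr (scale t)) (ratr (hyperbola_seq t).1) (ratr (hyperbola_seq t).2).
Proof. by apply/ffunP => i; rewrite ffunE frieze_curve_pt rmorph_curve_pt. Qed.

Lemma frieze_point_curve t : curve (ratr (scale t) : K) (frieze_point K t).
Proof.
rewrite frieze_pointE; do 2 eexists; split=> //.
have /(congr1 (ratr : rat -> K)) := hyperbola_seqP t.
by rewrite !(rmorphB, rmorphM, rmorphXn, rmorph_nat).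
Qed.

Lemma scale_step t j : scale (t + 6 * j) = scale t.
Proof. by rewrite /scale oddD oddM /= addbF. Qed.

(** The period 6 is even, so these points all lie on one curve. Their x-coordinates strictly
    increase, so they form an infinite, hence dense, subset. *)
Lemma frieze_componentE t : frieze_component K t = curve (ratr (scale t)).
Proof.
have c0 : ratr (scale t) != 0 :> K by rewrite fmorph_eq0 /scale; case: odd.
have sj j := scale_step t j.
apply: (cofinite_dense (curve_cofinite _ c0) _ (zclosed_curve _ c0)).
  by move=> _ [j _ <-]; have := frieze_point_curve (t + 6 * j); rewrite sj.
move=> l; have [j jl] : exists j, frieze_point K (t + 6 * j) \notin l.
  apply: infinite_notin => i j; rewrite !frieze_pointE !sj.
  move=> /(curve_pt_inj_x _ _ _ _ _ _ c0) /fmorph_inj.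
  have lt a b : (a < b)%N ->
      (hyperbola_seq (t + 6 * a)).1 < (hyperbola_seq (t + 6 * b)).1.
    move=> ab; have -> : (t + 6 * b = (6 * (b - a) - 2).+2 + (t + 6 * a))%N by lia.
    exact: hyperbola_seq_lt.
  by case: (ltngtP i j) => // /lt h e; move: h; rewrite e ltxx.
by exists (frieze_point K (t + 6 * j)) => //; exists j.
Qed.

Lemma frieze_varietyE : frieze_variety K = curve 1 `|` curve 2.
Proof.
have e1 : curve 1 = frieze_component K 0 by rewrite frieze_componentE rmorph1.
have e2 : curve 2 = frieze_component K 1 by rewrite frieze_componentE rmorph_nat.
apply/seteqP; split.
  apply: zclosure_min.
    by apply: zclosedU; apply: zclosed_curve; rewrite ?oner_neq0 ?pnatr_eq0.
  move=> _ [t _ <-]; have := frieze_point_curve t; rewrite /scale.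
  by case: odd; rewrite ?rmorph_nat ?rmorph1; [right|left].
(* Each curve is the closure of a subsequence of the frieze points. *)
rewrite e1 e2 => p.
by case; apply: zclosure_mono => _ [j _ <-]; eexists.
Qed.

(** The initial frieze point (1, ..., 1) separates them: on the second curve it would need x = 1/2
    and s = 5/2, but then s^2 - 5x^2 + 4 = 9. *)
Lemma curve1_neq_curve2 : curve (1 : K) <> curve 2.
Proof.
move=> e; have : curve (1 : K) (curve_pt 1 1 (-1)).
  by exists 1, (-1); split=> //; ring.
rewrite e => -[x [s [xs /ffunP pt]]].
have := pt (inord 0); have := pt (inord 1); rewrite !curve_pt_coord //= /y_of.
move=> ey ex; have x2 : x = 2^-1.
  by apply: (@mulfI _ 2); rewrite ?pnatr_eq0 // -ex; field.
have s5 : s = 5 / 2.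
  apply: (@mulfI _ 2^-1); rewrite ?invr_eq0 ?pnatr_eq0 //.
  rewrite x2 in ey.
  by transitivity ((3 * 2^-1 ^+ 2 + 2^-1 * s - 1) - 3 * 2^-1 ^+ 2 + 1);
    [|rewrite -ey]; field.
have : (9 : K) = 0.
  by rewrite -[RHS](subrr (5 * x ^+ 2 - 4)) -{1}xs x2 s5; field.
by move/eqP; rewrite pnatr_eq0.
Qed.

End FriezeVariety.

Theorem theorem5p9 (R : realType) :
  let X := frieze_variety R[i] in
  let X0 := frieze_component R[i] 0 in
  let X1 := frieze_component R[i] 1 in
  X = X0 `|` X1 /\
  X0 <> X1 /\
  rational_curve X0 /\
  rational_curve X1 /\
  groebner_basis (@lex_lt 7) (vanishing_ideal X0) (h_basis R[i]) /\
  groebner_basis (@lex_lt 7) (vanishing_ideal X1) (g_basis R[i]) /\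
  smooth X0 /\
  smooth X1.
Proof.
have c1 : (1 : R[i]) != 0 by rewrite oner_neq0.
have c2 : (2 : R[i]) != 0 by rewrite pnatr_eq0.
rewrite /= !frieze_componentE frieze_varietyE /= /scale /= rmorph1 rmorph_nat.
split; first exact: erefl.
split; first exact: curve1_neq_curve2.
split; first exact: rational_curve_curve.
split; first exact: rational_curve_curve.
split; first exact: groebner_curve h_basis_vanish h_basis_lead.
split; first exact: groebner_curve g_basis_vanish g_basis_lead.
by split; apply: smooth_curve.
Qed.
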